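(* Let $T>0$ be fixed, $h_n=T/n$. Let $k$ be the true number of factors, let $k^*\in\mathbb{N}$ with $\bar p-q_{k^*}>0$, let $0<\alpha\le1$, and assume the alternative hypothesis $H_1$: $k\ne k^*$. Suppose that: (i) there is $C>0$ with $|b_{k,0}(x)-b_{k,0}(y)|\le C|x-y|$ for all $x,y\in\mathbb{R}^k$; $\sup_{t}\mathbb{E}[|f_{k,t}|^\ell]<\infty$ for all $\ell\ge 0$; and $b_{k,0}\in C^4_\uparrow(\mathbb{R}^k)$; (ii) there is $C>0$ with $|B_{i,0}(x)-B_{i,0}(y)|\le C|x-y|$ for all $x,y\in\mathbb{R}$ and $i=1,\dots,p$; $\sup_{t}\mathbb{E}[|e_t|^\ell]<\infty$ for all $\ell\ge0$; and $B_{i,0}\in C^4_\uparrow(\mathbb{R})$ for $i=1,\dots,p$; (iii) $\sigma_i>0$ ($i=1,\dots,p$) for every parameter in $\Theta_k$ and every parameter in $\Theta_{k^*}$; (iv) $\mathrm{rank}\,\Delta_k=q_k$; (v) for $\theta_{k^*}\in\Theta_{k^*}$, $U_{k^*}(\theta_{k^*})=U_{k^*}(\bar\theta_{k^*})$ implies $\theta_{k^*}=\bar\theta_{k^*}$; (vi) $\Sigma_k(\theta_{k,0})\ne\Sigma_{k^*}(\bar\theta_{k^*})$. Then, as $h_n\to0$ (equivalently $n\to\infty$), the statistic $T_{k^*,n}=nF_{k^*,n}(Q_{XX},\Sigma_{k^*}(\hat\theta_{k^*,n}))$ satisfies $$\mathbb{P}\big(T_{k^*,n}>\chi^2_{\bar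 p-q_{k^*}}(\alpha)\big)\to1.$$
   Context: Fix integers $p\ge2$ and $r\ge1$. For each number of factors $m$ with $1\le m<p$ (used for $m=k$ and $m=k^*$) the parameter is $\theta_m=(\mathrm{vec}(A_m)^\top,\mathrm{vech}(\Sigma_{ff,m})^\top,\sigma_1^2,\dots,\sigma_p^2)^\top\in\Theta_m\subset\mathbb{R}^{q_m}$, where $A_m\in\mathbb{R}^{(p-m)\times m}$, $\Sigma_{ff,m}=S_mS_m^\top$ with $S_m\in\mathbb{R}^{m\times r}$, $q_m=(p-m)m+\frac{m(m+1)}2+p$, and $\Theta_m$ is convex and compact. $\Lambda_m\in\mathbb{R}^{p\times m}$ has top block $I_m$ and bottom block $A_m$, and $\Sigma_m(\theta_m)=\Lambda_m\Sigma_{ff,m}\Lambda_m^\top+\mathrm{diag}(\sigma_1^2,\dots,\sigma_p^2)$. The data come from the $k$-factor model with true parameter $\theta_{k,0}\in\mathrm{Int}(\Theta_k)$ (components $A_{k,0},\Sigma_{ff,k,0}=S_{k,0}S_{k,0}^\top,\sigma_{i,0}^2$, loading matrix $\Lambda_{k,0}$): $X_t=\Lambda_{k,0}f_{k,t}+e_t$, $t\in[0,T]$, with $df_{k,t}=b_{k,0}(f_{k,t})dt+S_{k,0}dW_t$, $f_{k,0}=c_1\in\mathbb{R}^k$, and $de^{(i)}_t=B_{i,0}(e^{(i)}_t)dt+\sigma_{i,0}dB^{(i)}_t$ ($i=1,\dots,p$), $e_0=c_2\in\mathbb{R}^p$; $W$ is an $r$-dimensional standard Wiener process, $B^{(1)},\dots,B^{(p)}$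 are independent one-dimensional standard Wiener processes independent of $W$; $b_{k,0}:\mathbb{R}^k\to\mathbb{R}^k$, $B_{i,0}:\mathbb{R}\to\mathbb{R}$; initial values are deterministic. Suprema over $t$ are over $[0,T]$. No ergodicity is assumed. Observations are $X_{t_i^n}$, $t_i^n=ih_n$, $0\le i\le n$, $T=nh_n$, and $Q_{XX}=\frac1T\sum_{i=1}^n(X_{t_i^n}-X_{t_{i-1}^n})(X_{t_i^n}-X_{t_{i-1}^n})^\top$. $\bar p=p(p+1)/2$; vec and vech are vectorization and half-vectorization; $D_p$ is the $p^2\times\bar p$ duplication matrix ($\mathrm{vec}A=D_p\mathrm{vech}A$ for symmetric $A$), $D_p^+=(D_p^\top D_p)^{-1}D_p^\top$, $W_m(\theta_m)=2D_p^+(\Sigma_m(\theta_m)\otimes\Sigma_m(\theta_m))D_p^{+\top}$. $\Delta_k$ is the $\bar p\times q_k$ Jacobian of $\theta_k\mapsto\mathrm{vech}(\Sigma_k(\theta_k))$ at $\theta_{k,0}$. $F_{k^*,n}(Q_{XX},\Sigma_{k^*}(\theta_{k^*}))=(\mathrm{vech}(Q_{XX})-\mathrm{vech}(\Sigma_{k^*}(\theta_{k^*})))^\top W_{k^*}^{-1}(\theta_{k^*})(\mathrm{vech}(Q_{XX})-\mathrm{vech}(\Sigma_{k^*}(\theta_{k^*})))$, and $\hat\theta_{k^*,n}$ is a minimizer of this function of $\theta_{k^*}$ over $\Theta_{k^*}$. $U_{k^*}(\theta_{k^*})=(\mathrm{vech}(\Sigma_k(\theta_{k,0}))-\mathrm{vech}(\Sigma_{k^*}(\theta_{k^*})))^\top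 W_{k^*}^{-1}(\theta_{k^*})(\mathrm{vech}(\Sigma_k(\theta_{k,0}))-\mathrm{vech}(\Sigma_{k^*}(\theta_{k^*})))$, and $\bar\theta_{k^*}$ is a minimizer of $U_{k^*}$ over $\Theta_{k^*}$. $\chi^2_m(\alpha)$ is the upper $\alpha$ point of the chi-squared distribution with $m$ degrees of freedom: the number $c\ge0$ such that a $\chi^2_m$ variable exceeds $c$ with probability $\alpha$. $C^4_\uparrow(\mathbb{R}^d)$ is the set of functions that are four times continuously differentiable and that, together with all derivatives up to order 4, have polynomial growth, i.e. are bounded in absolute value by $C(1+|x|)^C$ for some $C>0$ (componentwise for vector-valued functions). *)

(* Defs.v *)
From HB Require Import structures.
From mathcomp Require Import all_boot all_order all_algebra.
From mathcomp Require Import mxtens.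
From mathcomp Require Import zify.
From mathcomp Require Import all_classical all_reals all_analysis.

Set Implicit Arguments.
Unset Strict Implicit.
Unset Printing Implicit Defensive.

Import Order.TTheory GRing.Theory Num.Theory.
Import numFieldNormedType.Exports.

Local Open Scope classical_set_scope.
Local Open Scope ring_scope.

Definition vec (R : Type) (a b : nat) (A : 'M[R]_(a, b)) : 'cV[R]_(b * a) :=
  \col_k A (mxtens_unindex k).2 (mxtens_unindex k).1.

Definition unvec (R : Type) (a b : nat) (v : 'cV[R]_(b * a)) : 'M[R]_(a, b) :=
  \matrix_(i, j) v (mxtens_index (j, i)) 0.

Definition pbar (p : nat) : nat := (p * p.+1)./2.

(* The positions on or below the diagonal, column by column. *)
Definition vech_pairs (p : nat) : seq ('I_p * 'I_p) :=
  [seq (i, j) | j : 'I_p <- enum 'I_p,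
                i : 'I_p <- [seq i : 'I_p <- enum 'I_p | (j <= i)%N]].

Definition vech (R : nmodType) (p : nat) (A : 'M[R]_p) : 'cV[R]_(pbar p) :=
  \col_k [seq A ij.1 ij.2 | ij <- vech_pairs p]`_k.

Definition dup_mx (R : nzRingType) (p : nat) : 'M[R]_(p * p, pbar p) :=
  \matrix_(a, k)
    (let: (j, i) := mxtens_unindex a in
     index (if (j <= i)%N then (i, j) else (j, i)) (vech_pairs p) == k)%:R.

Definition dup_pinv (R : comUnitRingType) (p : nat) : 'M[R]_(pbar p, p * p) :=
  invmx ((dup_mx R p)^T *m dup_mx R p) *m (dup_mx R p)^T.

(* The symmetric matrix with half-vectorization [v]. *)
Definition unvech (R : nzRingType) (p : nat) (v : 'cV[R]_(pbar p)) : 'M[R]_p :=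
  unvec (dup_mx R p *m v).

Lemma vecK (R : Type) (a b : nat) : cancel (@vec R a b) (@unvec R a b).
Proof. by move=> A; apply/matrixP => i j; rewrite !mxE mxtens_indexK. Qed.

Lemma unvecK (R : Type) (a b : nat) : cancel (@unvec R a b) (@vec R a b).
Proof.
move=> v; apply/matrixP => i j; rewrite !mxE -surjective_pairing.
by rewrite mxtens_unindexK (ord1 j).
Qed.

Lemma size_vech_pairs p : size (vech_pairs p) = pbar p.
Proof.
rewrite /vech_pairs size_allpairs_dep sumnE big_map big_enum /=.
have cnt (j : 'I_p) : size [seq i : 'I_p <- enum 'I_p | (j <= i)%N] = (p - j)%N.
  rewrite size_filter -sum1_count big_enum_cond /=.
  have -> : (\sum_(i < p | (j <= i)%N) 1 = \sum_(0 <= i < p | (j <= i)%N) 1)%N.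
    by rewrite big_mkord.
  move: (nat_of_ord j) => {}j; elim: p => [|q IH]; first by rewrite big_geq.
  by rewrite big_mkcond big_nat_recr//= -big_mkcond IH; case: leqP => /= ?; lia.
under eq_bigr do rewrite cnt.
rewrite (reindex_inj rev_ord_inj) /pbar /=.
rewrite (eq_bigr (fun i : 'I_p => i.+1)); last by move=> i _; have := ltn_ord i; lia.
by clear cnt; elim: p => [|p IH]; [rewrite big_ord0|rewrite big_ord_recr /= IH; lia].
Qed.

Lemma uniq_vech_pairs p : uniq (vech_pairs p).
Proof.
apply: allpairs_uniq_dep => [||[a b] [c d] _ _ /= [] -> ->] //; first exact: enum_uniq.
by move=> j _; rewrite filter_uniq// enum_uniq.
Qed.

Lemma mem_vech_pairs p (i j : 'I_p) : ((i, j) \in vech_pairs p) = (j <= i)%N.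
Proof.
apply/allpairsPdep/idP => [[a [b [_]]]|ji].
  by rewrite mem_filter => /andP[ab _] [-> ->].
exists j, i; split=> //; first by rewrite mem_enum.
by rewrite mem_filter mem_enum andbT.
Qed.

Lemma dup_mx_vech (R : nzRingType) p (A : 'M[R]_p) :
  A^T = A -> dup_mx R p *m vech A = vec A.
Proof.
move=> sA; apply/matrixP => a z; rewrite !mxE.
case: (mxtens_indexP a) => j i; rewrite mxtens_indexK /=.
pose q := if (j <= i)%N then (i, j) else (j, i).
have qin : q \in vech_pairs p.
  by rewrite /q; case: leqP => h; rewrite mem_vech_pairs// ltnW.
have Aq : A q.1 q.2 = A i j.
  by rewrite /q; case: leqP => //= _; rewrite -[in LHS]sA mxE.
have hq : (index q (vech_pairs p) < pbar p)%N by rewrite -size_vech_pairs index_mem.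
rewrite (bigD1 (Ordinal hq)) //= big1 ?addr0; last first.
  move=> k /negP nk; rewrite !mxE mxtens_indexK /= -/q.
  case: eqP => [e|]; last by rewrite mul0r.
  by case: nk; apply/eqP/val_inj.
rewrite !mxE mxtens_indexK /= -/q eqxx mul1r.
by rewrite (nth_map q) ?index_mem// nth_index.
Qed.

Lemma unvechK (R : nzRingType) p : cancel (@unvech R p) (@vech R p).
Proof.
move=> v; apply/matrixP => k z; rewrite (ord1 z) mxE.
have hk : (k < size (vech_pairs p))%N by rewrite size_vech_pairs.
case E: (vech_pairs p) => [|x0 s]; first by move: hk; rewrite E.
rewrite -E (nth_map x0)//; case Eq : (nth x0 (vech_pairs p) k) => [i j] /=.
have ji : (j <= i)%N by rewrite -mem_vech_pairs -Eq mem_nth.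
rewrite !mxE (bigD1 k)//= big1 ?addr0.
  by rewrite !mxE mxtens_indexK /= ji -Eq index_uniq ?eqxx ?mul1r// uniq_vech_pairs.
move=> l /negP lk; rewrite !mxE mxtens_indexK /= ji -Eq index_uniq ?uniq_vech_pairs//.
by case: eqP => [e|]; [case: lk; apply/eqP/val_inj|rewrite mul0r].
Qed.

Lemma unvech_vech (R : nzRingType) p (A : 'M[R]_p) : A^T = A -> unvech (vech A) = A.
Proof. by move=> sA; rewrite /unvech dup_mx_vech// vecK. Qed.

Definition qdim (p m : nat) : nat := m * (p - m) + pbar m + p.

Definition loadA (R : Type) (p m : nat) (th : 'cV[R]_(qdim p m)) :
    'M[R]_(p - m, m) :=
  unvec (usubmx (usubmx th)).

Definition Sff (R : nzRingType) (p m : nat) (th : 'cV[R]_(qdim p m)) :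
    'M[R]_m :=
  unvech (dsubmx (usubmx th)).

Definition sigma2 (R : Type) (p m : nat) (th : 'cV[R]_(qdim p m)) : 'cV[R]_p :=
  dsubmx th.

Definition sigma (R : rcfType) (p m : nat) (th : 'cV[R]_(qdim p m)) (i : 'I_p)
    : R :=
  Num.sqrt (sigma2 th i 0).

(* For [m <= p], [conform_mx 0] only casts along [m + (p - m) = p]. *)
Definition Lambda (R : nzRingType) (p m : nat) (th : 'cV[R]_(qdim p m)) :
    'M[R]_(p, m) :=
  conform_mx 0 (col_mx 1%:M (loadA th)).

Lemma Lambda_cast (R : nzRingType) p m (hm : (m <= p)%N) (th : 'cV[R]_(qdim p m)) :
  Lambda th = castmx (subnKC hm, erefl) (col_mx 1%:M (loadA th)).
Proof.
rewrite /Lambda; move: (subnKC hm) => e.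
rewrite /conform_mx; case: eqP => // e'; case: eqP => // e2.
by rewrite (eq_irrelevance e2 erefl) (eq_irrelevance e e').
Qed.

Definition Sigma (R : nzRingType) (p m : nat) (th : 'cV[R]_(qdim p m)) :
    'M[R]_p :=
  Lambda th *m Sff th *m (Lambda th)^T + diag_mx (sigma2 th)^T.

Definition Wmx (R : comUnitRingType) (p m : nat) (th : 'cV[R]_(qdim p m)) :
    'M[R]_(pbar p) :=
  2%:R *: (dup_pinv R p *m tensmx (Sigma th) (Sigma th) *m (dup_pinv R p)^T).

(* [v = vech Q_XX] gives the contrast F, and [v] the half-vectorization of the
   true covariance matrix gives its limit U. *)
Definition contrast (R : comUnitRingType) (p m : nat) (v : 'cV[R]_(pbar p))
    (th : 'cV[R]_(qdim p m)) : R :=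
  ((v - vech (Sigma th))^T *m invmx (Wmx th) *m (v - vech (Sigma th))) 0 0.

Definition is_minimizer (R : numDomainType) (V : Type) (Theta : set V)
    (g : V -> R) (x : V) : Prop :=
  Theta x /\ forall y, Theta y -> g x <= g y.

Definition param_space (R : realType) (p m r : nat)
    (Theta : set 'cV[R]_(qdim p m)) : Prop :=
  [/\ convex_set (Theta : set (convex_lmodType 'cV[R]_(qdim p m))),
      compact Theta &
      forall th, Theta th ->
        (exists S : 'M[R]_(m, r), Sff th = S *m S^T) /\
        (forall i, 0 <= sigma2 th i 0)].

Definition Delta (R : realType) (p m : nat) (th0 : 'cV[R]_(qdim p m)) :
    'M[R]_(pbar p, qdim p m) :=
  \matrix_(i, j)
    'D_(delta_mx j 0) (fun th : 'cV[R]_(qdim p m) => vech (Sigma th) i 0) th0.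

Definition enorm (R : rcfType) (d : nat) (x : 'cV[R]_d) : R :=
  Num.sqrt (\sum_i x i 0 ^+ 2).

Fixpoint partials (R : realType) (d : nat) (s : seq 'I_d)
    (g : 'cV[R]_d -> R) : 'cV[R]_d -> R :=
  if s is i :: s' then 'D_(delta_mx i 0) (partials s' g) else g.

Definition poly_growth (R : realType) (d : nat) (g : 'cV[R]_d -> R) : Prop :=
  exists2 C : R, 0 < C & forall x, `|g x| <= C * (1 + enorm x) `^ C.

(* C^4 in terms of all iterated partial derivatives of order at most 4. *)
Definition C4up (R : realType) (d : nat) (g : 'cV[R]_d -> R) : Prop :=
  forall s : seq 'I_d, (size s <= 4)%N ->
    [/\ continuous (partials s g), poly_growth (partials s g) &
        (size s < 4)%N ->
        forall (i : 'I_d) x, derivable (partials s g) x (delta_mx i 0)].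

Definition gen_sigma d (Omega : measurableType d) (R : realType) (I : Type)
    (D : set I) (Z : I -> Omega -> R) : set (set Omega) :=
  <<s [set E | exists2 i, D i &
               exists2 A : set R, measurable A & E = Z i @^-1` A] >>.

Definition mutually_independent d (Omega : measurableType d) (R : realType)
    (P : probability Omega R) (I : finType) (G : I -> set (set Omega)) : Prop :=
  forall (J : {set I}) (E : I -> set Omega), (forall i, i \in J -> G i (E i)) ->
    P (\bigcap_(i in [set` J]) E i) = (\prod_(i in J) P (E i))%E.

Definition wiener d (Omega : measurableType d) (R : realType)
    (P : probability Omega R) (w : R -> Omega -> R) : Prop :=
  [/\ forall t, 0 <= t -> measurable_fun setT (w t),
      {ae P, forall om, w 0 om = 0},
      {ae P, forall om, {within `[0, +oo[, continuous (fun t => w t om)}},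
      forall s t : R, 0 <= s -> s < t -> forall A : set R, measurable A ->
        P ((fun om => w t om - w s om) @^-1` A)
        = normal_prob 0 (Num.sqrt (t - s)) A &
      forall s t : R, 0 <= s -> s < t -> forall (A : set R) (E : set Omega),
        measurable A -> gen_sigma `[0, s] w E ->
        let D := fun om => w t om - w s om in
        P (D @^-1` A `&` E) = (P (D @^-1` A) * P E)%E].

Definition wiener_vec d (Omega : measurableType d) (R : realType)
    (P : probability Omega R) (r : nat) (W : R -> Omega -> 'cV[R]_r) : Prop :=
  (forall j, wiener P (fun t om => W t om j 0)) /\
  mutually_independent P
    (fun j : 'I_r => gen_sigma `[0, +oo[ (fun t om => W t om j 0)).

(* The sigma-algebras of the noises: [None] stands for the whole vector [W],
   [Some i] for the scalar process [B^(i)]. *)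
Definition sigma_noise d (Omega : measurableType d) (R : realType) (p r : nat)
    (W : R -> Omega -> 'cV[R]_r) (B : R -> Omega -> 'cV[R]_p)
    (o : option 'I_p) : set (set Omega) :=
  if o is Some i then gen_sigma `[0, +oo[ (fun t om => B t om i 0)
  else gen_sigma [set tj : R * 'I_r | 0 <= tj.1]
                 (fun tj om => W tj.1 om tj.2 0).

(* [Y] is a continuous solution on [[0, T]] of [dY = b(Y) dt + S dW] with
   [Y_0 = x0]; since [S] is constant, the stochastic integral is [S W_t]. *)
Definition sde_solution d (Omega : measurableType d) (R : realType)
    (P : probability Omega R) (T : R) (n r : nat) (b : 'cV[R]_n -> 'cV[R]_n)
    (S : 'M[R]_(n, r)) (W : R -> Omega -> 'cV[R]_r) (x0 : 'cV[R]_n)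
    (Y : R -> Omega -> 'cV[R]_n) : Prop :=
  (forall t, 0 <= t <= T -> forall i, measurable_fun setT (fun om => Y t om i 0))
  /\ {ae P, forall om,
       {within `[0, T], continuous (fun t => Y t om)} /\
       forall t, 0 <= t <= T -> forall i,
         Y t om i 0 = x0 i 0
           + \int[lebesgue_measure]_(s in `[0, t]) (b (Y s om) i 0)
           + (S *m W t om) i 0}.

Definition bounded_moments d (Omega : measurableType d) (R : realType)
    (P : probability Omega R) (T : R) (n : nat) (Y : R -> Omega -> 'cV[R]_n)
    : Prop :=
  forall l : R, 0 <= l ->
    (ereal_sup [set 'E_P[fun om => (enorm (Y t om) `^ l)%R] | t in `[0%R, T]]
     < +oo)%E.

Definition QXX d (Omega : measurableType d) (R : realType) (T : R) (p : nat)
    (X : R -> Omega -> 'cV[R]_p) (n : nat) (om : Omega) : 'M[R]_p :=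
  let h := T / n%:R in
  T^-1 *: \sum_(i < n)
    (X (i.+1%:R * h) om - X (i%:R * h) om) *m
    (X (i.+1%:R * h) om - X (i%:R * h) om)^T.

Definition Gamma (R : realType) (z : R) : R :=
  \int[lebesgue_measure]_(x in `]0, +oo[) (x `^ (z - 1) * expR (- x)).

Definition chi2_pdf (R : realType) (m : nat) (x : R) : R :=
  if 0 < x then
    x `^ (m%:R / 2 - 1) * expR (- x / 2) / (2 `^ (m%:R / 2) * Gamma (m%:R / 2))
  else 0.

Definition chi2_prob (R : realType) (m : nat) (A : set R) : \bar R :=
  (\int[lebesgue_measure]_(x in A) (chi2_pdf m x)%:E)%E.

(* The upper [alpha] point, unique for [0 < alpha <= 1] and [0 < m]. *)
Definition chi2_upper (R : realType) (m : nat) (alpha : R) : R :=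
  xget 0 [set c : R | 0 <= c /\ chi2_prob m `]c, +oo[ = alpha%:E].

(* Main.v *)
Require Import Defs.
From HB Require Import structures.
From mathcomp Require Import all_boot all_order all_algebra.
From mathcomp Require Import mxtens ring lra.
From mathcomp Require Import all_classical all_reals all_analysis.
From mathcomp Require Import measurable_realfun.

(* The critical value is a constant, and the statistic is [n] times the minimum over the
   compact parameter set of the contrast at [vech Q_XX]. The increments of X differ from
   those of the martingale part G V, with V = (W, B) and G G^T the true covariance matrix,
   by O(h) drift terms along almost every path. The products of the increments of V are
   orthogonal in L^2, so Q_XX converges in probability to the true covariance matrix.
   By misspecification and compactness the contrast is bounded below by a positive constant
   over the parameter set, uniformly in a neighbourhood of the limit, so the statistic
   tends to infinity in probability. *)

Set Implicit Arguments.
Unset Strict Implicit.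
Unset Printing Implicit Defensive.

Import Order.TTheory GRing.Theory Num.Theory.
Import numFieldNormedType.Exports.

Local Open Scope classical_set_scope.
Local Open Scope ring_scope.

(** * Moments of normal variables *)

(** Drift and noise call for different modes of convergence. The Lipschitz constant [K] of the
    integrated drift depends on the path and comes with no moment bound, so the drift error, at most
    K^2 T^2 / n, is controlled almost surely and only then turned into a statement on probabilities.
    The noise is controlled in L^2, where orthogonality is decisive: n terms of second moment of
    order h^2 add up to order n h^2 = T^2 / n, whereas a plain triangle inequality would leave the
    constant n^2 h^2 = T^2. The cross terms between both parts are split by a weighted Young
    inequality, with a small weight on the bounded quadratic variation of the noise and a large one
    on the vanishing drift error. Gaussian moments come from one family of exact exponential
    expectations and 1 + x <= exp x, without integration by parts. The lower bound on the contrast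
    comes from Cauchy-Schwarz: an upper bound on the weight matrix bounds its inverse form from
    below, so that neither eigenvalues nor continuity of matrix inversion enter. *)

Section normal_moments.
Context {R : realType}.
Local Notation mu := (@lebesgue_measure R).

(** The Radon-Nikodym derivative of [normal_prob] and the explicit density have the same integral
    over every measurable set, hence agree almost everywhere; the change of variables for the former
    then yields the latter. *)
Lemma ge0_integral_normal_prob (m s : R) (f : R -> \bar R) :
  measurable_fun setT f -> (forall x, 0 <= f x)%E ->
  (\int[normal_prob m s]_x f x = \int[mu]_x (f x * (normal_pdf m s x)%:E))%E.
Proof.
move=> mf f0.
rewrite -(Radon_Nikodym_SigmaFinite.change_of_variables (normal_prob_dominates m s))//=.
have dom := normal_prob_dominates m s.
have intf := Radon_Nikodym_SigmaFinite.f_integrable dom.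
have mpdf : measurable_fun setT (EFin \o normal_pdf m s).
  by apply/measurable_EFinP; exact: measurable_normal_pdf.
apply: ae_eq_integral => //.
- by apply: emeasurable_funM => //; apply: (measurable_int mu).
- exact: emeasurable_funM.
- apply: ae_eqe_mul2l => /=.
  apply: integral_ae_eq => //=.
  by move=> E _ mE; rewrite -Radon_Nikodym_SigmaFinite.f_integral.
Qed.

(* The integrand is a ratio of two normal densities up to the factor [s' / s]. *)
Lemma integral_normal_ratio (s s' m : R) : 0 < s -> 0 < s' ->
  (\int[normal_prob 0 s]_x
     (expR (x ^+ 2 / (s ^+ 2 *+ 2) - (x - m) ^+ 2 / (s' ^+ 2 *+ 2)))%:E
   = (s' / s)%:E)%E.
Proof.
move=> s0 s'0; have pi0 := pi_gt0 R.
have [sn0 s'n0] : s != 0 /\ s' != 0 by split; rewrite gt_eqF.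
rewrite ge0_integral_normal_prob//=; last first.
  apply/measurable_EFinP/measurableT_comp => //.
  apply: measurable_funB; apply: measurable_funM => //.
  exact/measurable_funX/measurable_funB.
transitivity (\int[mu]_x ((s' / s)%:E * (normal_pdf m s' x)%:E))%E.
  apply: eq_integral => x _; rewrite -!EFinM !normal_pdfE//; congr (_%:E).
  rewrite /normal_fun subr0 mulrCA -expRD !mulNr.
  rewrite [_ - _ - _]addrC addKr.
  rewrite mulrA; congr (_ * _).
  have peakE t : 0 < t -> normal_peak t = (t * Num.sqrt (pi *+ 2))^-1.
    by move=> t0; rewrite /normal_peak -mulrnAr sqrtrM ?sqr_ge0// sqrtr_sqr gtr0_norm.
  rewrite !peakE//.
  have q0 : Num.sqrt (pi *+ 2) != 0 :> R by rewrite gt_eqF// sqrtr_gt0 pmulrn_lgt0.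
  by field; rewrite s'n0 q0.
rewrite integralZl//=; last exact: integrable_normal_pdf.
by rewrite integral_normal_pdf mule1.
Qed.

End normal_moments.

Section integrable_real.
Context d (T : measurableType d) (R : realType) (P : probability T R).
Implicit Types U V : T -> R.

Lemma integrable_addr U V : P.-integrable setT (EFin \o U) ->
  P.-integrable setT (EFin \o V) ->
  P.-integrable setT (EFin \o (fun w => U w + V w)).
Proof. by move=> iU iV; exact: (integrableD measurableT iU iV). Qed.

Lemma integrable_scaler (c : R) U : P.-integrable setT (EFin \o U) ->
  P.-integrable setT (EFin \o (fun w => c * U w)).
Proof. by move=> iU; exact: (integrableZl measurableT c iU). Qed.

Lemma integrable_affine (a c : R) U : P.-integrable setT (EFin \o U) ->
  P.-integrable setT (EFin \o (fun w => a + c * U w)).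
Proof.
move=> iU; apply: (@integrable_addr (cst a)); last exact: integrable_scaler.
exact: finite_measure_integrable_cst.
Qed.

Lemma Rintegral_affine (a c : R) U : P.-integrable setT (EFin \o U) ->
  \int[P]_w (a + c * U w) = a + c * \int[P]_w U w.
Proof.
move=> iU; rewrite (@RintegralD _ _ _ P _ (cst a))//=.
- by rewrite RintegralZl// Rintegral_cst//= probability_setT /= mulr1.
- exact: finite_measure_integrable_cst.
- exact: integrable_scaler.
Qed.

End integrable_real.

Section normal_variable.
Context d (T : measurableType d) (R : realType) (P : probability T R).
Variables (D : T -> R) (s : R).
Hypothesis mD : measurable_fun setT D.
Hypothesis s0 : 0 < s.
Hypothesis lawD : forall A, measurable A -> P (D @^-1` A) = normal_prob 0 s A.

(** Up to the factor s' / s, the likelihood ratio of N(m, s'^2) against N(0, s^2), evaluated at [D].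
    Its mean does not depend on [m]; varying [s'] and [m] produces all the moment information used
    below. *)
Let ratio (s' m : R) w :=
  expR (D w ^+ 2 / (s ^+ 2 *+ 2) - (D w - m) ^+ 2 / (s' ^+ 2 *+ 2)).

Let measurable_ratio s' m : measurable_fun setT (EFin \o ratio s' m).
Proof.
apply/measurable_EFinP/measurableT_comp => //.
apply: measurable_funB; apply: measurable_funM => //.
  exact: measurable_funX.
by apply: measurable_funX; apply: measurable_funB.
Qed.

Let expectation_ratio (s' m : R) : 0 < s' ->
  (\int[P]_w (ratio s' m w)%:E = (s' / s)%:E)%E.
Proof.
move=> s'0; rewrite -(integral_normal_ratio m s0 s'0).
pose D' : T -> measurableTypeR R := D.
have mD' : measurable_fun setT D' by exact: mD.
pose X : {mfun T >-> measurableTypeR R} := HB.pack D' (isMeasurableFun.Build _ _ _ _ D' mD').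
pose g (x : measurableTypeR R) : \bar R :=
  (expR (x ^+ 2 / (s ^+ 2 *+ 2) - (x - m) ^+ 2 / (s' ^+ 2 *+ 2)))%:E.
transitivity (\int[distribution P X]_x g x)%E.
  rewrite ge0_integral_distribution//.
    apply/measurable_EFinP/measurableT_comp => //.
    apply: measurable_funB; apply: measurable_funM => //.
    exact/measurable_funX/measurable_funB.
  by move=> x; rewrite lee_fin expR_ge0.
apply: eq_measure_integral => A mA _; exact: lawD.
Qed.

(* [D ^+ 4] is dominated by the exponential of a small multiple of [D ^+ 2]. *)
Lemma normal_integrable_pow4 :
  P.-integrable setT (EFin \o (fun w => D w ^+ 4)) /\
  (\int[P]_w (D w ^+ 4)%:E <= (57 * s ^+ 4)%:E)%E.
Proof.
(* Doubling the standard deviation leaves the exponent (1/2 - 1/8) y = 3 y / 8 with y = D^2 / s^2,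
   and gives [g] the mean 2. *)
pose g w := (ratio (s *+ 2) 0 w)%:E.
have Eg : (\int[P]_w g w = 2%:E)%E.
  by rewrite expectation_ratio ?pmulrn_lgt0// (mulrnAl s) divff ?gt_eqF.
have s4 : 0 <= (57 / 2) * s ^+ 4 by rewrite mulr_ge0// exprn_ge0// ltW.
have ub w : ((D w ^+ 4)%:E <= ((57 / 2) * s ^+ 4)%:E * g w)%E.
  rewrite /g /ratio subr0 -EFinM lee_fin.
  set y := D w ^+ 2 / s ^+ 2.
  have -> : D w ^+ 2 / (s ^+ 2 *+ 2) - D w ^+ 2 / ((s *+ 2) ^+ 2 *+ 2) = y * 3 / 8 by rewrite /y; field; rewrite gt_eqF.
  have -> : D w ^+ 4 = s ^+ 4 * y ^+ 2 by rewrite /y; field; rewrite gt_eqF.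
  rewrite [leRHS]mulrAC [leRHS]mulrC ler_wpM2l ?exprn_ge0// ?ltW//.
  have y0 : 0 <= y by rewrite /y divr_ge0// sqr_ge0.
  (* Squaring gives exp (3 y / 8) >= 9 y^2 / 256, and 256 / 9 < 57 / 2; with the mean 2 of [g] this
     is the origin of the constant 57. Only the order s^4 matters later. *)
  have h : 1 + y * 3 / 16 <= expR (y * 3 / 16) by exact: expR_ge1Dx.
  have -> : y * 3 / 8 = y * 3 / 16 + y * 3 / 16 by field.
  rewrite expRD; nra.
have mg : measurable_fun setT g by exact: measurable_ratio.
have m4 : measurable_fun setT (EFin \o (fun w => D w ^+ 4)).
  by apply/measurable_EFinP; exact: measurable_funX.
have le : (\int[P]_w (D w ^+ 4)%:E <= (57 * s ^+ 4)%:E)%E.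
  apply: (@le_trans _ _ (\int[P]_w (((57 / 2) * s ^+ 4)%:E * g w))%E).
    apply: ge0_le_integral => //=.
    - by move=> w _; rewrite lee_fin (exprM _ 2 2) sqr_ge0.
    - exact: measurable_funeM.
  rewrite ge0_integralZl//.
  - rewrite [X in (_ * X)%E]Eg -EFinM lee_fin le_eqVlt; apply/orP; left; apply/eqP.
    by rewrite mulr2n; field.
  - by move=> w _; rewrite lee_fin expR_ge0.
split=> //; apply/integrableP; split => //.
rewrite (eq_integral (fun w => (D w ^+ 4)%:E)) => [|w _ /=].
  by rewrite (le_lt_trans le)// ltry.
by rewrite ger0_norm// (exprM _ 2 2) sqr_ge0.
Qed.

Lemma normal_integrable_sqr : P.-integrable setT (EFin \o (fun w => D w ^+ 2)).
Proof.
have [i4 _] := normal_integrable_pow4.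
have i1 : P.-integrable setT (EFin \o (fun w => 1 + D w ^+ 4)).
  by under eq_fun do rewrite -[D _ ^+ 4]mul1r; exact: integrable_affine.
apply: le_integrable i1 => //.
  by apply/measurable_EFinP; exact: measurable_funX.
move=> w _ /=; rewrite lee_fin.
rewrite !ger0_norm ?sqr_ge0// ?addr_ge0//; last first.
  by rewrite (exprM _ 2 2) sqr_ge0.
by rewrite (exprM _ 2 2); nra.
Qed.

Lemma normal_integrable : P.-integrable setT (EFin \o D).
Proof.
have i1 : P.-integrable setT (EFin \o (fun w => 1 + D w ^+ 2)).
  under eq_fun do rewrite -[D _ ^+ 2]mul1r.
  by apply: integrable_affine; exact: normal_integrable_sqr.
apply: le_integrable i1 => //; first exact/measurable_EFinP.
move=> w _ /=; rewrite lee_fin [leRHS]ger0_norm ?addr_ge0 ?sqr_ge0//.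
rewrite -(real_normK (num_real (D w))); have := normr_ge0 (D w); nra.
Qed.

(* [1 + t D <= expR (t D)] gives [1 + t M <= expR (t ^+ 2 * s ^+ 2 / 2)] for the mean
   [M]; small [t] of either sign forces [M = 0]. *)
Lemma normal_mean0 : \int[P]_w D w = 0.
Proof.
set M := \int[P]_w D w.
have iD := normal_integrable.
have key t : 1 + t * M <= expR (t ^+ 2 * s ^+ 2 / 2).
  have := @expectation_ratio s (t * s ^+ 2) s0.
  rewrite divff ?gt_eqF// => Eg.
  have i1 : P.-integrable setT (EFin \o (fun w => 1 + t * D w)).
    exact: integrable_affine.
  have -> : 1 + t * M = \int[P]_w (1 + t * D w).
    by rewrite Rintegral_affine.
  have ir : P.-integrable setT (EFin \o ratio s (t * s ^+ 2)).
    apply/integrableP; split; first exact: measurable_ratio.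
    under eq_integral do rewrite gee0_abs ?lee_fin ?expR_ge0//.
    by rewrite /= Eg ltry.
  have -> : expR (t ^+ 2 * s ^+ 2 / 2) =
      \int[P]_w (expR (t ^+ 2 * s ^+ 2 / 2) * ratio s (t * s ^+ 2) w).
    by rewrite RintegralZl// /Rintegral Eg mulr1.
  apply: le_Rintegral => //; first exact: integrable_scaler.
  move=> w _; rewrite /ratio -expRD.
  rewrite [X in expR X](_ : _ = t * D w) ?expR_ge1Dx//.
  by field; rewrite gt_eqF.
(* Multiplying [key] by 1 - y <= exp (- y), with 1 - y nonnegative, removes the exponential. *)
have key2 t : t ^+ 2 * s ^+ 2 <= 2 -> (1 + t * M) * (1 - t ^+ 2 * s ^+ 2 / 2) <= 1.
  have := key t; set y := t ^+ 2 * s ^+ 2 / 2 => h1 y2.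
  have h2 : 1 - y <= expR (- y) by exact: expR_ge1Dx.
  have h4 : expR y * expR (- y) = 1 by rewrite expRN mulfV// gt_eqF// expR_gt0.
  rewrite -[leRHS]h4; have y1 : 0 <= 1 - y by rewrite /y; lra.
  apply: (@le_trans _ _ (expR y * (1 - y))); first by rewrite ler_wpM2r.
  by rewrite ler_wpM2l// expR_ge0.
apply/eqP/negPn/negP => M0.
have s2 : 0 < s ^+ 2 by rewrite exprn_gt0.
have M2 : 0 < M ^+ 2 by rewrite exprn_even_gt0.
(* The test value is t = c M, so that t M = c M^2 > 0. Since c, c s^2 and c M^2 s^2 sum to 1, the
   quadratic corrections stay below one half and cannot compensate this gain, which contradicts
   [key2]. *)
pose c := (1 + s ^+ 2 + M ^+ 2 * s ^+ 2)^-1.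
have c0 : 0 < c by rewrite invr_gt0 !addr_gt0// mulr_gt0.
have cE : c * (1 + s ^+ 2 + M ^+ 2 * s ^+ 2) = 1.
  by rewrite mulVf// gt_eqF// !addr_gt0// mulr_gt0.
have := key2 (c * M); rewrite [_ ^+ 2 * _](_ : _ = c * (c * (M ^+ 2 * s ^+ 2))); last by ring.
have -> : (1 + c * M * M) * (1 - c * (c * (M ^+ 2 * s ^+ 2)) / 2) =
  1 + c * M ^+ 2 * (1 - c * s ^+ 2 / 2 - c * (c * (M ^+ 2 * s ^+ 2)) / 2) by field.
have MS : 0 < M ^+ 2 * s ^+ 2 by rewrite mulr_gt0.
have a0 : 0 < c * s ^+ 2 by rewrite mulr_gt0.
have b0 : 0 < c * (M ^+ 2 * s ^+ 2) by rewrite mulr_gt0.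
have sumE : c + c * s ^+ 2 + c * (M ^+ 2 * s ^+ 2) = 1 by rewrite -cE; ring.
have c1 : c <= 1 by lra.
have b3 : c * (c * (M ^+ 2 * s ^+ 2)) <= c * (M ^+ 2 * s ^+ 2).
  by rewrite ler_piMl// ltW.
have b4 : 0 < c * M ^+ 2 * (1 - c * s ^+ 2 / 2 - c * (c * (M ^+ 2 * s ^+ 2)) / 2).
  by apply: mulr_gt0; [rewrite mulr_gt0|lra].
move=> /(_ ltac:(lra)); lra.
Qed.

(* [c D^2] is the exponent of [ratio (u * s) 0], whose mean is [u]; convexity gives
   [1 + c M <= u], and [u] tending to [1] from both sides forces [M = s ^+ 2]. *)
Lemma normal_second_moment : \int[P]_w (D w ^+ 2) = s ^+ 2.
Proof.
set M := \int[P]_w (D w ^+ 2).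
have iD := normal_integrable_sqr.
have key u : 0 < u -> 1 + (1 - u ^- 2) / (2 * s ^+ 2) * M <= u.
  move=> u0.
  have := @expectation_ratio (u * s) 0.
  rewrite mulr_gt0// mulfK ?gt_eqF// => /(_ erefl) Eg.
  set c := _ / _.
  have i1 : P.-integrable setT (EFin \o (fun w => 1 + c * D w ^+ 2)).
    exact: integrable_affine.
  have -> : 1 + c * M = \int[P]_w (1 + c * D w ^+ 2).
    by rewrite Rintegral_affine.
  have ir : P.-integrable setT (EFin \o ratio (u * s) 0).
    apply/integrableP; split; first exact: measurable_ratio.
    under eq_integral do rewrite gee0_abs ?lee_fin ?expR_ge0//.
    by rewrite /= Eg ltry.
  have -> : u = \int[P]_w ratio (u * s) 0 w by rewrite /Rintegral Eg.
  apply: le_Rintegral => // w _; rewrite /ratio.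
  rewrite [X in expR X](_ : _ = c * D w ^+ 2) ?expR_ge1Dx//.
  by rewrite /c subr0; field; rewrite !gt_eqF.
have s2 : 0 < s ^+ 2 by rewrite exprn_gt0.
have M0 : 0 <= M by apply: Rintegral_ge0 => w _; exact: sqr_ge0.
(* With u = 1 + t the denominators clear; dividing by t > 0 gives the upper bound [up], by t < 0 the
   lower bound [lo]. *)
have key2 t : -1 < t -> t * (2 + t) * M <= 2 * s ^+ 2 * t * (1 + t) ^+ 2.
  move=> t1; have u0 : 0 < 1 + t by lra.
  have := key _ u0.
  have -> : 1 + (1 - (1 + t) ^- 2) / (2 * s ^+ 2) * M =
    1 + t * (2 + t) * M / ((1 + t) ^+ 2 * (2 * s ^+ 2)).
    by field; rewrite !gt_eqF.
  rewrite lerD2l ler_pdivrMr; last by rewrite !mulr_gt0.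
  by move=> h; rewrite (le_trans h)//; nra.
have up t : 0 < t -> (2 + t) * M <= 2 * s ^+ 2 * (1 + t) ^+ 2.
  by move=> t0; rewrite -(ler_pM2l t0); have := key2 t ltac:(lra); lra.
have lo t : 0 < t < 1 -> 2 * s ^+ 2 * (1 - t) ^+ 2 <= (2 - t) * M.
  by move=> /andP[t0 t1]; rewrite -(ler_pM2l t0); have := key2 (- t) ltac:(lra); lra.
apply/eqP; rewrite eq_le; apply/andP; split; rewrite leNgt; apply/negP => h.
(* An explicit small t instead of a limit: c lies in (0, 1), so c^2 <= c, and [up] becomes 2 (M -
   s^2) <= c (6 s^2 - M). Replacing M - s^2 by c (M + 5 s^2) makes this impossible; the other case
   is symmetric. *)
- pose c := (M - s ^+ 2) / (M + 5 * s ^+ 2).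
  have d0 : 0 < M + 5 * s ^+ 2 by nra.
  have c0 : 0 < c by rewrite divr_gt0// subr_gt0.
  have cE : c * (M + 5 * s ^+ 2) = M - s ^+ 2 by rewrite divfK// gt_eqF.
  have c1 : c < 1 by rewrite ltr_pdivrMr//; nra.
  have := up c c0; have : c ^+ 2 <= c by nra.
  nra.
- pose c := (s ^+ 2 - M) / (M + 5 * s ^+ 2).
  have d0 : 0 < M + 5 * s ^+ 2 by nra.
  have c0 : 0 < c by rewrite divr_gt0// subr_gt0.
  have cE : c * (M + 5 * s ^+ 2) = s ^+ 2 - M by rewrite divfK// gt_eqF.
  have c1 : c < 1 by rewrite ltr_pdivrMr//; nra.
  have := lo c; rewrite c0 c1 => /(_ erefl); have : c ^+ 2 <= c by nra.
  nra.
Qed.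

End normal_variable.

(** * Independence *)

Section independence.
Context d (T : measurableType d) (R : realType) (P : probability T R).

Definition independent_rv (U V : T -> R) := forall A B : set R,
  measurable A -> measurable B ->
  P (U @^-1` A `&` V @^-1` B) = (P (U @^-1` A) * P (V @^-1` B))%E.

Lemma independent_rv_comp U V (f g : R -> R) :
  measurable_fun setT f -> measurable_fun setT g ->
  independent_rv U V -> independent_rv (f \o U) (g \o V).
Proof.
move=> mf mg h A B mA mB; apply: (h (f @^-1` A) (g @^-1` B)).
  by rewrite -[X in measurable X]setTI; exact: mf.
by rewrite -[X in measurable X]setTI; exact: mg.
Qed.

Variables U V : T -> R.
Hypotheses (iU : P.-integrable setT (EFin \o U)) (iV : P.-integrable setT (EFin \o V)).
Hypothesis UV : independent_rv U V.

Let mU : measurable_fun setT U. Proof. exact/measurable_EFinP/measurable_int/iU. Qed.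
Let mV : measurable_fun setT V. Proof. exact/measurable_EFinP/measurable_int/iV. Qed.
Let U' : {mfun T >-> R} := HB.pack U (isMeasurableFun.Build _ _ _ _ U mU).
Let V' : {mfun T >-> R} := HB.pack V (isMeasurableFun.Build _ _ _ _ V mV).
Let mUV : measurable_fun setT (fun w => (U w, V w)).
Proof. exact: measurable_fun_pair. Qed.
Let UV' : {mfun T >-> (R * R)%type} := HB.pack (fun w => (U w, V w))
   (isMeasurableFun.Build _ _ _ _ (fun w => (U w, V w)) mUV).
(** Independence is agreement of the joint law with the product law on rectangles, and rectangles
    determine the product measure. *)
Let prodE A : measurable A ->
  (distribution P U' \x distribution P V')%E A = distribution P UV' A.
Proof.
apply: product_measure_unique => {}A B mA mB.
exact: UV.
Qed.
Let f (z : R * R) : \bar R := (z.1 * z.2)%:E.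
Let mf : measurable_fun setT f.
Proof.
by apply/measurable_EFinP; apply: measurable_funM.
Qed.

Let iUd : (distribution P U').-integrable setT (EFin : R -> \bar R).
Proof. by apply: integrable_pushforward. Qed.
Let iVd : (distribution P V').-integrable setT (EFin : R -> \bar R).
Proof. by apply: integrable_pushforward. Qed.

(** By Tonelli the iterated integral of |x y| factors into two finite first absolute moments. *)
Let if_prod : (distribution P U' \x distribution P V')%E.-integrable setT f.
Proof.
apply/integrable12ltyP => //.
rewrite (eq_integral (fun x : R => `|x%:E| *
    \int[distribution P V']_y `|y%:E|)%E) => [|x _]; last first.
  under eq_integral do rewrite /f EFinM abseM /=.
  rewrite /= ge0_integralZl//; exact: measurableT_comp.
have [_] := integrableP _ _ _ iVd => /= hV.
have [_] := integrableP _ _ _ iUd => /= hU.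
rewrite ge0_integralZr//=; last 2 first.
- by apply/measurable_EFinP; apply: normr_measurable.
- exact: integral_ge0.
apply: lte_mul_pinfty => //; first exact: integral_ge0.
by rewrite ge0_fin_numE// integral_ge0.
Qed.

Lemma independent_integrableM : P.-integrable setT (EFin \o (fun w => U w * V w)).
Proof.
apply/integrableP; split.
  by apply/measurable_EFinP; exact: measurable_funM.
have [_] := integrableP _ _ _ if_prod.
rewrite (eq_measure_integral (distribution P UV')) => [|A mA _]; last exact: prodE.
by rewrite ge0_integral_distribution//; exact: measurableT_comp.
Qed.

Lemma independent_expectationM :
  \int[P]_w (U w * V w) = (\int[P]_w U w) * (\int[P]_w V w).
Proof.
rewrite /Rintegral -fineM; [|exact: integrable_fin_num..]; congr fine.
transitivity (\int[distribution P UV']_z f z)%E.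
  by rewrite integral_distribution//; exact: independent_integrableM.
transitivity (\int[distribution P U' \x distribution P V']_z f z)%E.
  by apply: eq_measure_integral => A mA _; exact/esym/prodE.
rewrite -integral12_prod_meas1// /fubini_F.
have -> : (\int[P]_w (U w)%:E = \int[distribution P U']_x x%:E)%E.
  by rewrite integral_distribution.
have EV : (\int[P]_w (V w)%:E = \int[distribution P V']_x x%:E)%E.
  by rewrite integral_distribution.
have fV : (\int[P]_w (V w)%:E)%E \is a fin_num by exact: integrable_fin_num.
rewrite -(fineK fV) -integralZr//; apply: eq_integral => x _.
rewrite fineK// EV; under eq_integral do rewrite /f EFinM.
by rewrite integralZl.
Qed.

End independence.

(** * Increments of Wiener processes *)

Section square_integrable.
Context d (T : measurableType d) (R : realType) (P : probability T R).

Lemma chebyshev_sqr (S : T -> R) (eps c : R) : 0 < eps ->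
  P.-integrable setT (EFin \o (fun w => S w ^+ 2)) -> measurable_fun setT S ->
  \int[P]_w (S w ^+ 2) <= c ->
  (P [set w | (eps <= `|S w|)%R] <= (c / eps ^+ 2)%:E)%E.
Proof.
move=> e0 iS mS Sc.
have e2 : 0 < eps ^+ 2 by rewrite exprn_gt0.
rewrite EFinM lee_pdivlMr// muleC.
have mS2 := measurable_int _ iS.
have := le_integral_abse P measurableT mS2 e2.
rewrite setTI [X in (_ * P X)%E](_ : _ = [set w | (eps <= `|S w|)%R]); last first.
  apply/seteqP; split=> w /=; rewrite lee_fin (ger0_norm (sqr_ge0 (S w)));
  by rewrite -(real_normK (num_real (S w))) ler_pXn2r// ?nnegrE// ltW.
move=> h; apply: le_trans h _.
rewrite (eq_integral (fun w => (S w ^+ 2)%:E)) => [|w _ /=]; last first.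
  by rewrite ger0_norm// sqr_ge0.
by rewrite -(fineK (integrable_fin_num _ iS))// lee_fin.
Qed.

(** Pythagoras in L^2: the bound grows like n and not like n^2. *)
Lemma orthogonal_sum (Z : nat -> T -> R) (c : R) (n : nat) :
  (forall i, P.-integrable setT (EFin \o (fun w => Z i w ^+ 2)) /\
     \int[P]_w (Z i w ^+ 2) <= c) ->
  (forall i j, (i < j)%N -> P.-integrable setT (EFin \o (fun w => Z i w * Z j w)) /\
     \int[P]_w (Z i w * Z j w) = 0) ->
  P.-integrable setT (EFin \o (fun w => (\sum_(i < n) Z i w) ^+ 2)) /\
  \int[P]_w ((\sum_(i < n) Z i w) ^+ 2) <= n%:R * c.
Proof.
move=> Z2 Z0.
(* A partial sum is orthogonal to every later term, so each new term contributes its own second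
   moment only. *)
have ZS (m j : nat) : (m <= j)%N ->
    P.-integrable setT (EFin \o (fun w => (\sum_(i < m) Z i w) * Z j w)) /\
    \int[P]_w ((\sum_(i < m) Z i w) * Z j w) = 0.
  elim: m => [_|m IH mj].
    have E : (fun w => (\sum_(i < 0) Z i w) * Z j w) = cst 0.
      by apply/funext => w; rewrite big_ord0 mul0r.
    by rewrite E; split; [exact: integrable0|rewrite Rintegral_cst//= mul0r].
  have [i1 e1] := IH (ltnW mj); have [i2 e2] := Z0 _ _ mj.
  have E : (fun w => (\sum_(i < m.+1) Z i w) * Z j w) =
      (fun w => (\sum_(i < m) Z i w) * Z j w + Z m w * Z j w).
    by apply/funext => w; rewrite big_ord_recr/= mulrDl.
  rewrite E; split; first exact: integrable_addr.
  by rewrite RintegralD// e1 e2 addr0.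
elim: n => [|n [iS hS]].
  have E : (fun w => (\sum_(i < 0) Z i w) ^+ 2) = cst 0.
    by apply/funext => w; rewrite big_ord0 expr0n.
  by rewrite E; split; [exact: integrable0|rewrite Rintegral_cst//= !mul0r].
have [i1 e1] := ZS n n (leqnn n); have [i2 e2] := Z2 n.
have E : (fun w => (\sum_(i < n.+1) Z i w) ^+ 2) = (fun w =>
    ((\sum_(i < n) Z i w) ^+ 2 + Z n w ^+ 2) + 2 * ((\sum_(i < n) Z i w) * Z n w)).
  by apply/funext => w; rewrite big_ord_recr/=; ring.
have i3 := integrable_addr iS i2.
have i4 := integrable_scaler 2 i1.
rewrite E; split; first exact: integrable_addr.
rewrite RintegralD// RintegralD// RintegralZl// e1 mulr0 addr0.
by rewrite -natr1 mulrDl mul1r lerD.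
Qed.

End square_integrable.

(** * Measurability with respect to generated sigma-algebras *)

Section generated.
Context d (T : measurableType d) (R : realType) (P : probability T R).

(** The generating family inside [gen_sigma], named so that [g_sigma_algebraType] can equip the
    sample space with that sigma-algebra. Belonging to a past or to one noise is then ordinary
    measurability, stable under differences, products and powers. *)
Definition generators (I : Type) (D : set I) (Z : I -> T -> R) : set (set T) :=
  [set E | exists2 i, D i & exists2 A : set R, measurable A & E = Z i @^-1` A].

Lemma gen_sigma_measurable (I : Type) (D : set I) (Z : I -> T -> R)
    (U : g_sigma_algebraType (generators D Z) -> R) :
  measurable_fun setT U <-> forall A, measurable A -> gen_sigma D Z (U @^-1` A).
Proof.
split=> mU => [A mA|_ A mA]; last by rewrite setTI; exact: mU.
by rewrite -[X in gen_sigma _ _ X]setTI; exact: mU.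
Qed.

Lemma measurable_generator (I : Type) (D : set I) (Z : I -> T -> R) i : D i ->
  measurable_fun setT (Z i : g_sigma_algebraType (generators D Z) -> R).
Proof.
by move=> Di; apply/gen_sigma_measurable => A mA; apply: sub_gen_smallest; exists i => //; exists A.
Qed.

Lemma measurable_increment (D : set R) (Z : R -> T -> R) s t : D s -> D t ->
  measurable_fun setT ((fun w => Z t w - Z s w) : g_sigma_algebraType (generators D Z) -> R).
Proof. by move=> *; apply: measurable_funB; exact: measurable_generator. Qed.

Lemma gen_sigma_independent (I J : Type) (D : set I) (Z : I -> T -> R)
    (D' : set J) (Z' : J -> T -> R)
    (U : g_sigma_algebraType (generators D Z) -> R)
    (V : g_sigma_algebraType (generators D' Z') -> R) :
  (forall E F, gen_sigma D Z E -> gen_sigma D' Z' F -> P (E `&` F) = (P E * P F)%E) ->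
  measurable_fun setT U -> measurable_fun setT V -> independent_rv P U V.
Proof. by move=> h /gen_sigma_measurable mU /gen_sigma_measurable mV A B mA mB; rewrite h; auto. Qed.

End generated.

Section wiener_increments.
Context d (T : measurableType d) (R : realType) (P : probability T R).
Variables (u : R -> T -> R) (u_wiener : wiener P u).

Definition increment (v : R -> T -> R) (h : R) (i : nat) (w : T) : R :=
  v (i.+1%:R * h) w - v (i%:R * h) w.

Variable h : R.
Hypothesis h0 : 0 < h.

Let grid_ge0 i : 0 <= i%:R * h. Proof. by rewrite mulr_ge0// ltW. Qed.
Let grid_lt i : i%:R * h < i.+1%:R * h. Proof. by rewrite ltr_pM2r// ltr_nat. Qed.

Lemma measurable_wiener_increment i : measurable_fun setT (increment u h i).
Proof. by case: u_wiener => mu _ _ _ _; apply: measurable_funB; apply: mu. Qed.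

Lemma wiener_increment_law i A : measurable A ->
  P (increment u h i @^-1` A) = normal_prob 0 (Num.sqrt h) A.
Proof.
case: u_wiener => _ _ _ law _ mA.
have := law _ _ (grid_ge0 i) (grid_lt i) A mA.
by rewrite -mulrBl (_ : i.+1%:R - i%:R = 1) ?mul1r// -natr1 addrAC subrr add0r.
Qed.

Let s0 : 0 < Num.sqrt h. Proof. by rewrite sqrtr_gt0. Qed.
Let ss : Num.sqrt h ^+ 2 = h. Proof. by rewrite sqr_sqrtr// ltW. Qed.

Lemma integrable_wiener_increment i : P.-integrable setT (EFin \o increment u h i).
Proof. exact: (normal_integrable (measurable_wiener_increment i) s0 (@wiener_increment_law i)). Qed.

Lemma integrable_wiener_increment2 i :
  P.-integrable setT (EFin \o (fun w => increment u h i w ^+ 2)).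
Proof. exact: (normal_integrable_sqr (measurable_wiener_increment i) s0 (@wiener_increment_law i)). Qed.

Lemma integrable_wiener_increment4 i :
  P.-integrable setT (EFin \o (fun w => increment u h i w ^+ 4)).
Proof. exact: (normal_integrable_pow4 (measurable_wiener_increment i) s0 (@wiener_increment_law i)).1. Qed.

Lemma wiener_increment_mean i : \int[P]_w increment u h i w = 0.
Proof. exact: (normal_mean0 (measurable_wiener_increment i) s0 (@wiener_increment_law i)). Qed.

Lemma wiener_increment_var i : \int[P]_w (increment u h i w ^+ 2) = h.
Proof. by rewrite (normal_second_moment (measurable_wiener_increment i) s0 (@wiener_increment_law i)). Qed.

Lemma wiener_increment_pow4 i : \int[P]_w (increment u h i w ^+ 4) <= 57 * h ^+ 2.
Proof.
have [i4] := (normal_integrable_pow4 (measurable_wiener_increment i) s0 (@wiener_increment_law i)).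
by rewrite (exprM _ 2 2) ss -(fineK (integrable_fin_num _ i4))// lee_fin.
Qed.

(** Step [i] ends at (i+1) h <= j h, so its increment belongs to the past of time j h, from which
    increment [j] is independent. *)
Lemma wiener_increment_independent i j : (i < j)%N ->
  independent_rv P (increment u h i) (increment u h j).
Proof.
move=> ij; case: u_wiener => _ _ _ _ ind A B mA mB.
rewrite setIC muleC (ind _ _ (grid_ge0 j) (grid_lt j))//.
apply: ((gen_sigma_measurable (increment u h i)).1 _ _ mA).
apply: measurable_increment;
  by rewrite /= in_itv/= grid_ge0 ler_pM2r// ler_nat// ltnW.
Qed.

(** The centred squares have mean zero and are pairwise independent, hence orthogonal; their second
    moment is the fourth moment of the increment minus h^2, below 57 h^2. *)
Lemma quadratic_variation_L2 (n : nat) :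
  let S w := \sum_(i < n) (increment u h i w ^+ 2 - h) in
  P.-integrable setT (EFin \o (fun w => S w ^+ 2)) /\
  \int[P]_w (S w ^+ 2) <= n%:R * (57 * h ^+ 2).
Proof.
have iZ i : P.-integrable setT (EFin \o (fun w => increment u h i w ^+ 2 - h)).
  rewrite (_ : (fun w => _) = (fun w => - h + 1 * increment u h i w ^+ 2)).
    by apply: integrable_affine; exact: integrable_wiener_increment2.
  by apply/funext => w; rewrite mul1r addrC.
have EZ i : \int[P]_w (increment u h i w ^+ 2 - h) = 0.
  rewrite (_ : (fun w => _) = (fun w => - h + 1 * increment u h i w ^+ 2)).
    rewrite Rintegral_affine; last exact: integrable_wiener_increment2.
    by rewrite wiener_increment_var mul1r addNr.
  by apply/funext => w; rewrite mul1r addrC.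
apply: (@orthogonal_sum _ _ _ _ (fun i w => increment u h i w ^+ 2 - h)) => [i|i j ij].
  have E : (fun w => (increment u h i w ^+ 2 - h) ^+ 2) =
      (fun w => (h ^+ 2 + 1 * increment u h i w ^+ 4) + (- (2 * h)) * increment u h i w ^+ 2).
    by apply/funext => w; ring.
  have i1 := integrable_affine (h ^+ 2) 1 (integrable_wiener_increment4 i).
  have i2 := integrable_scaler (- (2 * h)) (integrable_wiener_increment2 i).
  rewrite E; split; first exact: integrable_addr.
  rewrite RintegralD// RintegralZl//; last exact: integrable_wiener_increment2.
  rewrite Rintegral_affine; last exact: integrable_wiener_increment4.
  rewrite wiener_increment_var.
  by have := wiener_increment_pow4 i; have := sqr_ge0 h; nra.
have ind : independent_rv P (fun w => increment u h i w ^+ 2 - h)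
    (fun w => increment u h j w ^+ 2 - h).
  apply: (independent_rv_comp (f := fun x => x ^+ 2 - h) (g := fun x => x ^+ 2 - h)).
  - by apply: measurable_funB => //; exact: measurable_funX.
  - by apply: measurable_funB => //; exact: measurable_funX.
  - exact: wiener_increment_independent.
split; first exact: independent_integrableM.
by rewrite (independent_expectationM (iZ i) (iZ j) ind) !EZ mul0r.
Qed.

End wiener_increments.

Section wiener_covariation.
Context d (T : measurableType d) (R : realType) (P : probability T R).
Variables (u v : R -> T -> R) (u_wiener : wiener P u) (v_wiener : wiener P v).
Hypothesis uv : forall E F, gen_sigma `[0, +oo[ u E -> gen_sigma `[0, +oo[ v F ->
  P (E `&` F) = (P E * P F)%E.
Variable h : R.
Hypothesis h0 : 0 < h.

Let measurable_incr (w : R -> T -> R) i : measurable_fun setT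
  ((increment w h i : T -> R) : g_sigma_algebraType (generators `[0, +oo[ w) -> R).
Proof.
by apply: measurable_increment; rewrite /= in_itv/= andbT mulr_ge0// ltW.
Qed.

(** Cross terms are regrouped by process instead of by time: the two increments of [u] are
    independent of the two of [v], and each pair has a product of mean zero. *)
Lemma quadratic_covariation_L2 (n : nat) :
  let S w := \sum_(i < n) (increment u h i w * increment v h i w) in
  P.-integrable setT (EFin \o (fun w => S w ^+ 2)) /\
  \int[P]_w (S w ^+ 2) <= n%:R * (57 * h ^+ 2).
Proof.
apply: (@orthogonal_sum _ _ _ _ (fun i w => increment u h i w * increment v h i w))
  => [i|i j ij].
  have E : (fun w => (increment u h i w * increment v h i w) ^+ 2) =
      (fun w => increment u h i w ^+ 2 * increment v h i w ^+ 2).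
    by apply/funext => w; rewrite exprMn.
  have iu := integrable_wiener_increment2 u_wiener h0 i.
  have iv := integrable_wiener_increment2 v_wiener h0 i.
  have ind : independent_rv P (fun w => increment u h i w ^+ 2)
      (fun w => increment v h i w ^+ 2).
    apply: (gen_sigma_independent uv); apply: measurable_funX; exact: measurable_incr.
  rewrite E; split; first exact: independent_integrableM.
  (* The second moment is h^2 exactly; the factor 57 only gives this case the same bound as the
     quadratic variation. *)
  rewrite independent_expectationM// !wiener_increment_var//.
  by rewrite -expr2 ler_peMl ?sqr_ge0// ler1n.
have E : (fun w => (increment u h i w * increment v h i w) *
    (increment u h j w * increment v h j w)) =
    (fun w => (increment u h i w * increment u h j w) *
    (increment v h i w * increment v h j w)).
  by apply/funext => w; rewrite mulrACA.
have indu := wiener_increment_independent u_wiener h0 ij.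
have indv := wiener_increment_independent v_wiener h0 ij.
have iu := independent_integrableM (integrable_wiener_increment u_wiener h0 i)
  (integrable_wiener_increment u_wiener h0 j) indu.
have iv := independent_integrableM (integrable_wiener_increment v_wiener h0 i)
  (integrable_wiener_increment v_wiener h0 j) indv.
have ind : independent_rv P (fun w => increment u h i w * increment u h j w)
    (fun w => increment v h i w * increment v h j w).
  by apply: (gen_sigma_independent uv); apply: measurable_funM; exact: measurable_incr.
rewrite E; split; first exact: independent_integrableM.
rewrite independent_expectationM// independent_expectationM//.
- by rewrite wiener_increment_mean// mul0r mul0r.
- exact: integrable_wiener_increment.
- exact: integrable_wiener_increment.
Qed.

End wiener_covariation.

(** * Drift along paths, and vanishing events *)

Section paths.
Context {R : realType}.
Local Notation mu := (@lebesgue_measure R).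

(** The constant is the maximum of |g| on the compact interval. For [g] the drift along a path it
    therefore depends on the path. *)
Lemma lipschitz_integral (T : R) (g : R -> R) : 0 < T ->
  {within `[0, T], continuous g} ->
  exists K : R, forall s t, 0 <= s -> s <= t -> t <= T ->
  `|\int[mu]_(x in `[0, t]) g x - \int[mu]_(x in `[0, s]) g x| <= K * (t - s).
Proof.
move=> T0 cg; have cng : {within `[0, T], continuous (fun x => `|g x|)}.
  by move=> x; apply: cvg_norm; exact: cg.
have [c _ Kc] := EVT_max (ltW T0) cng.
exists `|g c| => s t s0 st tT.
have iT : mu.-integrable `[0, T] (EFin \o g).
  by apply: continuous_compact_integrable => //; exact: segment_compact.
have it : mu.-integrable `[0, t] (EFin \o g).
  by apply: integrableS iT => //; apply: subset_itvl; rewrite bnd_simp.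
have ist : mu.-integrable `]s, t] (EFin \o g).
  by apply: integrableS it => //; apply: subset_itvr; rewrite bnd_simp.
rewrite Rintegral_itvB ?bnd_simp//.
apply: (le_trans (le_normr_Rintegral _ ist)) => //.
apply: (@le_trans _ _ (\int[mu]_(x in `]s, t]) `|g c|)).
  apply: le_Rintegral => //.
  - exact: integrable_norm.
  - apply/integrableP; split; first exact: measurable_cst.
    rewrite integral_cst//= lebesgue_measure_itv/= lte_fin.
    by case: ifP => _; rewrite ?mule0 ?ltry// -EFinD -EFinM ltry.
  - move=> x; rewrite /= in_itv/= => /andP[sx xt]; apply: Kc.
    by rewrite in_itv/= (le_trans s0 (ltW sx)) (le_trans xt).
rewrite Rintegral_cst//= lebesgue_measure_itv/= lte_fin.
move: st; rewrite le_eqVlt => /predU1P[->|st]; first by rewrite ltxx subrr !mulr0.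
by rewrite st.
Qed.

Lemma sde_increment_bound d (Omega : measurableType d) (P : probability Omega R)
    (T : R) (n r : nat) (b : 'cV[R]_n -> 'cV[R]_n) (S : 'M[R]_(n, r)) W x0 Y :
  0 < T -> sde_solution P T b S W x0 Y ->
  (forall i, continuous (fun x => b x i 0)) ->
  {ae P, forall om, exists K : R, forall s t, 0 <= s -> s <= t -> t <= T ->
    forall i, `|Y t om i 0 - Y s om i 0 - (S *m (W t om - W s om)) i 0| <= K * (t - s)}.
Proof.
move=> T0 [_ sol] cb; apply: filterS sol => om [cY solE].
have /choice[K hK] (i : 'I_n) := lipschitz_integral T0
  (@within_continuous_comp _ _ _ _ (Y^~ om) (fun x : 'cV[R]_n => b x i 0) (fun x _ => @cb i x) cY).
exists (\sum_i `|K i|) => s t s0 st tT i.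
rewrite !solE ?s0 ?(le_trans s0 st) ?tT ?(le_trans st tT)// mulmxBr.
rewrite [(S *m _ - _) i 0]mxE [(- (S *m W s om)) i 0]mxE.
rewrite [leLHS](_ : _ = `|\int[mu]_(x in `[0, t]) (b (Y x om) i 0) -
    \int[mu]_(x in `[0, s]) (b (Y x om) i 0)|); last by congr (`|_|); ring.
apply: (le_trans (hK i s t s0 st tT)).
rewrite ler_wpM2r ?subr_ge0// (le_trans (ler_norm _))//.
by rewrite (bigD1 i)//= lerDl sumr_ge0.
Qed.

End paths.

Section vanishing.
Context d (T : measurableType d) (R : realType) (P : probability T R).

(** Convergence in probability as a calculus of bad events. Measurability is bundled because
    monotonicity and subadditivity of [P] require it. *)
Definition vanishing (B : nat -> set T) :=
  (forall n, measurable (B n)) /\ P (B n) @[n --> \oo] --> 0%E.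

Lemma vanishing_sub (A B : nat -> set T) : (forall n, measurable (A n)) ->
  vanishing B -> (\forall n \near \oo, A n `<=` B n) -> vanishing A.
Proof.
move=> mA [mB B0] AB; split=> //.
apply: (squeeze_cvge _ (cvg_cst 0%E) B0).
near=> n; apply/andP; split; first exact: measure_ge0.
by apply: le_measure; rewrite ?inE//; near: n.
Unshelve. all: end_near. Qed.

Lemma vanishingU (A B : nat -> set T) : vanishing A -> vanishing B ->
  vanishing (fun n => A n `|` B n).
Proof.
move=> [mA A0] [mB B0]; split=> [n|]; first exact: measurableU.
have AB0 : P (A n) + P (B n) @[n --> \oo] --> 0%E.
  by rewrite -[X in _ --> X]adde0; apply: cvgeD.
apply: (squeeze_cvge _ (cvg_cst 0%E) AB0).
by apply: nearW => n; rewrite measure_ge0/= measureU2.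
Qed.

Lemma vanishing_exists (I : finType) (B : I -> nat -> set T) :
  (forall i, vanishing (B i)) -> vanishing (fun n => [set w | exists i, B i n w]).
Proof.
move=> vB; have : forall s : seq I,
    vanishing (fun n => [set w | exists2 i, i \in s & B i n w]).
  elim=> [|i s IH].
    rewrite (_ : (fun n => _) = fun=> set0); last first.
      by apply/funext => n; apply/seteqP; split=> // w [].
    by split=> //; rewrite measure0; exact: cvg_cst.
  rewrite (_ : (fun n => _) = fun n => B i n `|` [set w | exists2 i, i \in s & B i n w]).
    exact: vanishingU.
  apply/funext => n; apply/seteqP; split=> w.
    by move=> [j]; rewrite inE => /predU1P[-> ?|js ?]; [left|right; exists j].
  by move=> [?|[j js ?]]; [exists i; rewrite ?mem_head|exists j; rewrite ?inE ?js ?orbT].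
move=> /(_ (enum I)); congr vanishing; apply/funext => n; apply/seteqP; split=> w.
  by move=> [i _ Bi]; exists i.
by move=> [i Bi]; exists i; rewrite ?mem_enum.
Qed.

(** Continuity from above: [F n] excludes every bad event from index [n] on, these sets increase to
    a set of full measure, and [B n] lies in the complement of [F n]. *)
Lemma ae_vanishing (B : nat -> set T) : (forall n, measurable (B n)) ->
  {ae P, forall w, \forall n \near \oo, ~ B n w} -> vanishing B.
Proof.
move=> mB aeB; split=> //.
pose F n := \bigcap_(m in [set m | (n <= m)%N]) ~` B m.
have mF n : measurable (F n) by apply: bigcap_measurableType => m _; exact: measurableC.
have ndF : nondecreasing_seq F.
  by move=> m n mn; apply/subsetPset => w Fw k /= nk; apply: Fw; exact: leq_trans nk.
have mUF : measurable (\bigcup_n F n) by exact: bigcup_measurable.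
have NF : P (~` \bigcup_n F n) = 0%E.
  apply/negligibleP; first exact: measurableC.
  apply: negligibleS aeB; apply: subsetC => w /= [N _ BN].
  by exists N => // m /= Nm; exact: BN.
have cF : P (~` F n) @[n --> \oo] --> 0%E.
  rewrite -NF [X in P X]setC_bigcup.
  apply: nonincreasing_cvg_mu.
  - by rewrite (le_lt_trans (probability_le1 _ _)) ?ltry//; exact: measurableC.
  - by move=> n; exact: measurableC.
  - by apply: bigcapT_measurable => n; exact: measurableC.
  - by move=> m n mn; apply/subsetPset/subsetC/subsetPset/ndF.
apply: (squeeze_cvge _ (cvg_cst 0%E) cF); apply: nearW => n.
rewrite measure_ge0/=; apply: le_measure; rewrite ?inE//; first exact: measurableC.
by move=> w Bw Fw; exact: (Fw n (leqnn n)).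
Qed.

Lemma vanishingC (B : nat -> set T) : vanishing B -> P (~` B n) @[n --> \oo] --> 1%E.
Proof.
move=> [mB B0].
rewrite (_ : (fun n => _) = fun n => (1 - P (B n))%E); last first.
  by apply/funext => n; rewrite probability_setC.
rewrite -[X in _ --> X]sube0; apply: cvgeB => //; exact: cvg_cst.
Qed.

End vanishing.

(** * Realized covariance *)

(** With a = x - m and b = y - m', the difference x y - m m' is a m' + m b + a b. Young's inequality
    with weight [eta] splits the two mixed products: the part in [m], [m'] is made small by [eta],
    the part in [a], [b] is small because the drift error vanishes. *)
Lemma sum_cross_bound (R : realType) (n : nat) (eta : R) (x y m m' : 'I_n -> R) : 0 < eta ->
  `|\sum_i x i * y i - \sum_i m i * m' i| <=
    ((2 * eta)^-1 + 2^-1) * (\sum_i (x i - m i) ^+ 2 + \sum_i (y i - m' i) ^+ 2)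
    + eta / 2 * (\sum_i m i ^+ 2 + \sum_i m' i ^+ 2).
Proof.
move=> e0; rewrite -sumrB -!big_split/= !mulr_sumr -big_split/=.
apply: (le_trans (ler_norm_sum _ _ _)); apply: ler_sum => i _.
move: (x i) (y i) (m i) (m' i) => {x y m m'} x y m m'.
set a := x - m; set b := y - m'.
have -> : x * y - m * m' = a * m' + m * b + a * b by rewrite /a /b; ring.
have AM (s t : R) : `|s * t| <= (2 * eta)^-1 * s ^+ 2 + eta / 2 * t ^+ 2.
  have -> : (2 * eta)^-1 * s ^+ 2 + eta / 2 * t ^+ 2 = `|s * t| +
      (2 * eta)^-1 * (`|s| - eta * `|t|) ^+ 2.
    rewrite normrM -(real_normK (num_real s)) -(real_normK (num_real t)).
    by field; rewrite gt_eqF.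
  by rewrite lerDl mulr_ge0 ?sqr_ge0// invr_ge0 mulr_ge0// ltW.
have ab : `|a * b| <= 2^-1 * (a ^+ 2 + b ^+ 2).
  by rewrite ler_norml; apply/andP; split;
    have := sqr_ge0 (a + b); have := sqr_ge0 (a - b); nra.
have h1 := AM a m'; have h2 := AM b m; rewrite (mulrC b m) in h2.
have := ler_normD (a * m' + m * b) (a * b); have := ler_normD (a * m') (m * b).
move: h1 h2 ab; set A := (2 * eta)^-1; set B := eta / 2; set C := 2^-1.
move: (`|a * m'|) (`|m * b|) (`|a * b|) (`|a * m' + m * b|) => z1 z2 z3 z4.
by move: (a ^+ 2) (b ^+ 2) (m ^+ 2) (m' ^+ 2) => a2 b2 m2 m'2; lra.
Qed.

Section realized_covariance.
Context d (Omega : measurableType d) (R : realType) (P : probability Omega R).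
Variables (T : R) (p m : nat).
Hypothesis T0 : 0 < T.
Variables (V : R -> Omega -> 'cV[R]_m) (G : 'M[R]_(p, m)) (X : R -> Omega -> 'cV[R]_p).
Let Vc a t om := V t om a 0.
Let Xc u t om := X t om u 0.
Hypothesis V_wiener : forall a, wiener P (Vc a).
Hypothesis V_indep : forall a b, a != b -> forall E F,
  gen_sigma `[0, +oo[ (Vc a) E -> gen_sigma `[0, +oo[ (Vc b) F ->
  P (E `&` F) = (P E * P F)%E.
Hypothesis mX : forall t, 0 <= t <= T -> forall u, measurable_fun setT (Xc u t).
Hypothesis X_path : {ae P, forall om, exists K : R, forall s t, 0 <= s -> s <= t -> t <= T ->
    forall u, `|X t om u 0 - X s om u 0 - (G *m (V t om - V s om)) u 0| <= K * (t - s)}.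

Let h n : R := T / n%:R.
Let dV a n i := increment (Vc a) (h n) i.
Let dX u n i := increment (Xc u) (h n) i.
Let dM u n i om := \sum_a G u a * dV a n i om.

Let h_ge0 n : 0 <= h n. Proof. by rewrite divr_ge0// ltW. Qed.
Let nh n : (0 < n)%N -> n%:R * h n = T.
Proof. by move=> n0; rewrite mulrC divfK// pnatr_eq0 -lt0n. Qed.

Let grid n i : (i <= n)%N -> 0 <= i%:R * h n <= T.
Proof.
case: n => [|n] le_in; first by move: le_in; rewrite leqn0 => /eqP->; rewrite mul0r lexx ltW.
by rewrite mulr_ge0//= -[leRHS](@nh n.+1)// ler_wpM2r// ler_nat.
Qed.

Let measurable_dV a n i : measurable_fun setT (dV a n i).
Proof.
by have [mV _ _ _ _] := V_wiener a; apply: measurable_funB; apply: mV; rewrite mulr_ge0.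
Qed.

Let measurable_dX u n (i : 'I_n) : measurable_fun setT (dX u n i).
Proof. by apply: measurable_funB; apply: mX; apply: grid => //; exact: ltnW. Qed.

Let measurable_dM u n i : measurable_fun setT (dM u n i).
Proof. by apply: measurable_sum => a; exact: measurable_funM. Qed.

Let N a b n om := \sum_(i < n) dV a n i om * dV b n i om - (a == b)%:R * T.
Let Err u n om := \sum_(i < n) (dX u n i om - dM u n i om) ^+ 2.

(** Chebyshev applied to the L^2 bounds, with n * 57 h^2 = 57 T^2 / n. On the diagonal, n h = T
    turns the centring of each square by h into the single subtraction of T. *)
Lemma vanishing_noise_covariation a b delta : 0 < delta ->
  vanishing P (fun n => [set om | delta <= `|N a b n om|]).
Proof.
move=> d0.
have mN n : measurable_fun setT (N a b n).
  apply: measurable_funB => //; apply: measurable_sum => i.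
  exact: measurable_funM.
split=> [n|].
  rewrite -[X in measurable X]setTI.
  by apply: measurable_fun_le => //; exact: measurableT_comp.
have ub n : (0 < n)%N ->
    (P [set om | (delta <= `|N a b n om|)%R] <= (57 * T ^+ 2 / delta ^+ 2 / n%:R)%:E)%E.
  move=> n0; have hn0 : 0 < h n by rewrite divr_gt0// ltr0n.
  have -> : 57 * T ^+ 2 / delta ^+ 2 / n%:R = n%:R * (57 * h n ^+ 2) / delta ^+ 2.
    by rewrite /h; field; rewrite ?pnatr_eq0 -?lt0n ?n0 ?gt_eqF.
  have [eab|nab] := eqVneq a b.
    rewrite -eab; have [i2 e2] := quadratic_variation_L2 (V_wiener a) hn0 n.
    have NE om : N a a n om = \sum_(i < n) (dV a n i om ^+ 2 - h n).
      rewrite /N eqxx mul1r sumrB sumr_const card_ord -mulr_natl nh//.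
    have -> : [set om | delta <= `|N a a n om|] =
        [set om | delta <= `|\sum_(i < n) (dV a n i om ^+ 2 - h n)|].
      by apply/seteqP; split => om /=; rewrite NE.
    apply: chebyshev_sqr => //.
    by apply: measurable_sum => i; apply: measurable_funB => //; exact: measurable_funX.
  have [i2 e2] := quadratic_covariation_L2 (V_wiener a) (V_wiener b) (V_indep nab) hn0 n.
  have NE om : N a b n om = \sum_(i < n) (dV a n i om * dV b n i om).
    by rewrite /N (negbTE nab) mul0r subr0.
  have -> : [set om | delta <= `|N a b n om|] =
      [set om | delta <= `|\sum_(i < n) (dV a n i om * dV b n i om)|].
    by apply/seteqP; split => om /=; rewrite NE.
  apply: chebyshev_sqr => //.
  by apply: measurable_sum => i; exact: measurable_funM.
have c0 : (57 * T ^+ 2 / delta ^+ 2 / n%:R)%:E @[n --> \oo] --> (0:R)%:E.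
  apply: cvg_EFin; first exact: nearW.
  rewrite -[X in _ --> X](mulr0 (57 * T ^+ 2 / delta ^+ 2)).
  apply: cvgMr; apply/gtr0_cvgV0; last exact: cvgr_idn.
  by near=> n; rewrite ltr0n; near: n; exact: nbhs_infty_gt.
apply: (squeeze_cvge _ (cvg_cst 0%E) c0).
near=> n; rewrite measure_ge0/=; apply: ub; near: n; exact: nbhs_infty_gt.
Unshelve. all: end_near. Qed.

(** Along almost every path the error is at most n (K h)^2 = K^2 T^2 / n. As [K] is random without
    an integrability bound, the argument passes through [ae_vanishing] and not through moments. *)
Lemma vanishing_drift u rho : 0 < rho ->
  vanishing P (fun n => [set om | rho <= Err u n om]).
Proof.
move=> r0.
have mE n : measurable_fun setT (Err u n).
  apply: measurable_sum => i; apply: measurable_funX; exact: measurable_funB.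
apply: ae_vanishing => [n|].
  by rewrite -[X in measurable X]setTI; apply: measurable_fun_le.
apply: filterS X_path => om [K hK].
pose M := K ^+ 2 * T ^+ 2.
near=> n; rewrite /= => rE.
have n0 : (0 < n)%N by near: n; exact: nbhs_infty_gt.
have nM : M / rho < n%:R by near: n; exact: nbhs_infty_gtr.
have EM : Err u n om <= n%:R * (K * h n) ^+ 2.
  rewrite [leRHS](_ : _ = \sum_(i < n) (K * h n) ^+ 2); last first.
    by rewrite sumr_const card_ord mulr_natl.
  apply: ler_sum => i _.
  have [_ t1] := andP (grid (ltn_ord i)); have [s0 _] := andP (grid (ltnW (ltn_ord i))).
  have st : i%:R * h n <= i.+1%:R * h n by rewrite ler_wpM2r// ler_nat.
  have := hK _ _ s0 st t1 u.
  have -> : i.+1%:R * h n - i%:R * h n = h n.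
    by rewrite -mulrBl -natr1 addrAC subrr add0r mul1r.
  have -> : (G *m (V (i.+1%:R * h n) om - V (i%:R * h n) om)) u 0 = dM u n i om.
    by rewrite mxE; apply: eq_bigr => a _; rewrite !mxE.
  rewrite -(real_normK (num_real (_ - _))) => le1.
  by rewrite ler_pXn2r ?nnegrE// (le_trans _ le1).
have : rho * n%:R <= M.
  rewrite -ler_pdivlMr ?ltr0n// (le_trans rE)// (le_trans EM)//.
  rewrite le_eqVlt; apply/orP; left; apply/eqP; rewrite /M /h.
  by field; rewrite pnatr_eq0 -lt0n.
by rewrite ltr_pdivrMr// mulrC in nM; move/(lt_le_trans nM); rewrite ltxx.
Unshelve. all: end_near. Qed.

Lemma QXX_entry n om u v :
  QXX T X n om u v = T^-1 * \sum_(i < n) dX u n i om * dX v n i om.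
Proof.
rewrite /QXX mxE summxE; congr (_ * _); apply: eq_bigr => i _.
by rewrite mxE big_ord1 !mxE.
Qed.

Lemma measurable_QXX n u v : measurable_fun setT (fun om => QXX T X n om u v).
Proof.
under eq_fun do rewrite QXX_entry.
apply: measurable_funM => //; apply: measurable_sum => i.
exact: measurable_funM.
Qed.

Let noise_covariation n om u v :
  \sum_(i < n) dM u n i om * dM v n i om =
  T * (G *m G^T) u v + \sum_a \sum_b G u a * G v b * N a b n om.
Proof.
transitivity (\sum_a \sum_b G u a * G v b * (\sum_(i < n) dV a n i om * dV b n i om)).
  under eq_bigr do rewrite /dM mulr_suml.
  rewrite exchange_big; apply: eq_bigr => a _ /=.
  under eq_bigr do rewrite mulr_sumr.
  rewrite exchange_big; apply: eq_bigr => b _ /=.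
  by rewrite mulr_sumr; apply: eq_bigr => i _; ring.
rewrite mxE mulr_sumr -big_split/=; apply: eq_bigr => a _.
rewrite mxE -[X in X + _](_ : \sum_b G u a * G v b * ((a == b)%:R * T) = _).
  by rewrite -big_split/=; apply: eq_bigr => b _; rewrite /N; ring.
rewrite (bigD1 a)//= eqxx big1 ?addr0 => [|b nb]; first by rewrite mul1r; ring.
by rewrite eq_sym (negbTE nb) mul0r mulr0.
Qed.

Lemma QXX_cvg_in_probability eps : 0 < eps ->
  vanishing P (fun n => [set om | exists uv : 'I_p * 'I_p,
    eps <= `|QXX T X n om uv.1 uv.2 - (G *m G^T) uv.1 uv.2|]).
Proof.
move=> e0.
(* Summing over all four indices makes one [delta] serve every entry. The bound g * delta <= 1
   yields the bound [s] on the sums of squares of [dM], and g * delta <= q the error of the noise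
   covariation. *)
pose g := \sum_u \sum_a \sum_v \sum_b `|G u a| * `|G v b|.
pose s := T * (\sum_u (G *m G^T) u u) + 1.
have GG0 u : 0 <= (G *m G^T) u u.
  by rewrite mxE sumr_ge0// => a _; rewrite mxE -expr2 sqr_ge0.
have g0 : 0 <= g by do 4 (apply: sumr_ge0 => ? _); rewrite mulr_ge0.
have s1 : 1 <= s by rewrite /s lerDr mulr_ge0 ?(ltW T0)// sumr_ge0.
(* Error budget after multiplication by T: one [q] for the drift part (through [rho]), one for the
   Young remainder (through [eta]), one for the noise covariation; the fourth makes the inequality
   strict. *)
pose q := T * eps / 4.
have q0 : 0 < q by rewrite divr_gt0// mulr_gt0.
pose delta := Num.min 1 q / (g + 1).
have d0 : 0 < delta by rewrite divr_gt0 ?lt_min ?ltr01 ?q0// ltr_wpDl.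
have gd : g * delta <= Num.min 1 q.
  rewrite /delta mulrCA ler_piMr// ?le_min ?ler01 ?(ltW q0)//.
  by rewrite ler_pdivrMr ?mul1r ?lerDl// ltr_wpDl.
have [gd1 gdq] : g * delta <= 1 /\ g * delta <= q by move: gd; rewrite le_min => /andP.
pose eta := q / s.
have s0 : 0 < s by rewrite (lt_le_trans _ s1).
have eta0 : 0 < eta by rewrite divr_gt0.
pose c := (2 * eta)^-1 + 2^-1.
have c0 : 0 < c by rewrite /c addr_gt0// invr_gt0// mulr_gt0.
pose rho := q / (2 * c).
have r0 : 0 < rho by rewrite divr_gt0// mulr_gt0.
apply: (vanishing_sub _ (vanishingU
  (vanishing_exists (fun ab : 'I_m * 'I_m => vanishing_noise_covariation ab.1 ab.2 d0))
  (vanishing_exists (fun u : 'I_p => vanishing_drift u r0)))).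
  move=> n; rewrite (_ : [set _ | _] = \bigcup_(uv in [set: 'I_p * 'I_p])
    [set om | eps <= `|QXX T X n om uv.1 uv.2 - (G *m G^T) uv.1 uv.2|]); last first.
    by apply/seteqP; split=> om [uv]; [move=> ?; exists uv|move=> _ ?; exists uv].
  apply: fin_bigcup_measurable => // uv _.
  rewrite -[X in measurable X]setTI; apply: measurable_fun_le => //.
  by apply: measurableT_comp => //; apply: measurable_funB => //; exact: measurable_QXX.
apply: nearW => n om [[u v] /= bad]; apply: contrapT => /not_orP[/forallNP hN /forallNP hE].
move: bad; apply/negP; rewrite -ltNge.
have Nd a b : `|N a b n om| <= delta by rewrite ltW// ltNge; apply/negP; exact: (hN (a, b)).
have Er w : Err w n om <= rho by rewrite ltW// ltNge; apply/negP; exact: hE.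
have Mb w w' : `|\sum_(i < n) dM w n i om * dM w' n i om - T * (G *m G^T) w w'| <= g * delta.
  rewrite noise_covariation addrAC subrr add0r.
  apply: (le_trans (ler_norm_sum _ _ _)).
  apply: (@le_trans _ _ (\sum_a \sum_b `|G w a| * `|G w' b| * delta)).
    apply: ler_sum => a _; apply: (le_trans (ler_norm_sum _ _ _)).
    by apply: ler_sum => b _; rewrite !normrM ler_wpM2l// mulr_ge0.
  under eq_bigr do rewrite -mulr_suml.
  rewrite -mulr_suml ler_wpM2r// ?(ltW d0)// /g (bigD1 w)//=.
  apply: ler_wpDr; first by do 4 (apply: sumr_ge0 => ? _); rewrite mulr_ge0.
  apply: ler_sum => a _; rewrite (bigD1 w')//=; apply: ler_wpDr => //.
  by do 2 (apply: sumr_ge0 => ? _); rewrite mulr_ge0.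
have Ms w : \sum_(i < n) dM w n i om ^+ 2 <= s.
  have := Mb w w; rewrite ler_norml => /andP[_]; rewrite lerBlDl => h1.
  under eq_bigr do rewrite expr2.
  apply: (le_trans h1); rewrite /s lerD// ler_wpM2l ?(ltW T0)//.
  by rewrite (bigD1 w)//= lerDl sumr_ge0.
have := sum_cross_bound (fun i : 'I_n => dX u n i om) (fun i => dX v n i om)
  (fun i => dM u n i om) (fun i => dM v n i om) eta0.
rewrite -/c => hc.
have h1 : c * (Err u n om + Err v n om) <= q.
  apply: (@le_trans _ _ (c * (rho + rho))); first by rewrite ler_wpM2l ?(ltW c0)// lerD.
  by rewrite le_eqVlt; apply/orP; left; apply/eqP; rewrite /rho; field; rewrite gt_eqF.
have h2 : eta / 2 * (\sum_(i < n) dM u n i om ^+ 2 + \sum_(i < n) dM v n i om ^+ 2) <= q.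
  apply: (@le_trans _ _ (eta / 2 * (s + s))).
    by apply: ler_wpM2l; [rewrite divr_ge0// ltW|exact: lerD].
  by rewrite le_eqVlt; apply/orP; left; apply/eqP; rewrite /eta; field; rewrite gt_eqF.
have h3 := Mb u v.
rewrite -(ltr_pM2l T0) -[X in X * `|_|](gtr0_norm T0) -normrM mulrBr QXX_entry mulVKf ?gt_eqF//.
have h4 := ler_normD (\sum_(i < n) dX u n i om * dX v n i om - \sum_(i < n) dM u n i om * dM v n i om)
  (\sum_(i < n) dM u n i om * dM v n i om - T * (G *m G^T) u v).
rewrite addrA subrK in h4.
apply: (le_lt_trans h4); apply: (@le_lt_trans _ _ (q + q + q)); last first.
  by have -> : T * eps = q + q + q + q; [rewrite /q; field|rewrite ltrDl].
by apply: lerD; [exact: (le_trans hc (lerD h1 h2))|exact: le_trans h3 gdq].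
Qed.

End realized_covariance.

(** * Positivity of the contrast *)

Section linear_algebra.
Context {R : realType}.

Definition sqnorm (n : nat) (x : 'cV[R]_n) : R := \sum_i x i 0 ^+ 2.

Lemma sqnormE n (x : 'cV[R]_n) : (x^T *m x) 0 0 = sqnorm x.
Proof. by rewrite mxE; apply: eq_bigr => i _; rewrite mxE expr2. Qed.

Lemma sqnorm_ge0 n (x : 'cV[R]_n) : 0 <= sqnorm x.
Proof. by apply: sumr_ge0 => i _; exact: sqr_ge0. Qed.

Lemma sqnorm_eq0 n (x : 'cV[R]_n) : sqnorm x = 0 -> x = 0.
Proof.
move=> /eqP; rewrite psumr_eq0 => [|i _]; last exact: sqr_ge0.
move=> /allP h; apply/matrixP => i j; rewrite ord1 mxE.
by have := h i (mem_index_enum _); rewrite /= sqrf_eq0 => /eqP.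
Qed.

Lemma cauchy_schwarz n (x y : 'cV[R]_n) :
  (x^T *m y) 0 0 ^+ 2 <= sqnorm x * sqnorm y.
Proof.
have [y0|yn0] := eqVneq (sqnorm y) 0.
  by rewrite (sqnorm_eq0 y0) mulmx0 mxE expr0n/= mulr_ge0// sqnorm_ge0.
have yp : 0 < sqnorm y by rewrite lt0r yn0 sqnorm_ge0.
set B := (x^T *m y) 0 0.
have : 0 <= sqnorm (sqnorm y *: x - B *: y) by exact: sqnorm_ge0.
have expand (b c : R) : sqnorm (c *: x - b *: y) =
    c ^+ 2 * sqnorm x - 2 * c * b * B + b ^+ 2 * sqnorm y.
  rewrite /B mxE /sqnorm !mulr_sumr -sumrB -big_split/=.
  by apply: eq_bigr => i _; rewrite !mxE; ring.
rewrite expand (_ : _ + _ = sqnorm y * (sqnorm x * sqnorm y - B ^+ 2)); last by ring.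
by rewrite pmulr_rge0// subr_ge0.
Qed.

Lemma gram_unitmx n m (M : 'M[R]_(n, m)) :
  (forall v : 'rV_n, v *m M = 0 -> v = 0) -> M *m M^T \in unitmx.
Proof.
move=> inj; rewrite unitmxE unitfE; apply/negP => /det0P[v vn0 vM].
move/negP: vn0; apply; apply/eqP/inj.
have : sqnorm (v *m M)^T = 0.
  by rewrite -sqnormE trmxK trmx_mul mulmxA -(mulmxA v) vM mul0mx mxE.
by move=> /sqnorm_eq0 /(congr1 trmx); rewrite trmxK trmx0.
Qed.

Lemma gram_inverse_form n m (M : 'M[R]_(n, m)) (x : 'cV[R]_n) :
  M *m M^T \in unitmx ->
  (x^T *m invmx (M *m M^T) *m x) 0 0 = sqnorm (M^T *m (invmx (M *m M^T) *m x)).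
Proof.
set W := M *m M^T => Wu.
have WT : W^T = W by rewrite trmx_mul trmxK.
have Wz : W *m (invmx W *m x) = x by rewrite mulKVmx.
have zT : (invmx W *m x)^T = x^T *m invmx W by rewrite trmx_mul trmx_inv WT.
move: (invmx W *m x) zT Wz => z zT Wz.
by rewrite -sqnormE trmx_mul trmxK -zT !mulmxA -(mulmxA _ M) -/W -(mulmxA z^T) Wz.
Qed.

(** Cauchy-Schwarz for M^T x and M^T z, where z = (M M^T)^-1 x: their inner product is x^T M M^T z =
    |x|^2. An upper bound on the matrix thus bounds the form of its inverse from below. *)
Lemma gram_inverse_bound n m (M : 'M[R]_(n, m)) (x : 'cV[R]_n) :
  M *m M^T \in unitmx ->
  sqnorm x ^+ 2 <=
    (x^T *m (M *m M^T) *m x) 0 0 * (x^T *m invmx (M *m M^T) *m x) 0 0.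
Proof.
move=> Wu; rewrite gram_inverse_form//.
have Wz : (M *m M^T) *m (invmx (M *m M^T) *m x) = x by rewrite mulKVmx.
move: (invmx _ *m x) Wz => z Wz.
have -> : (x^T *m (M *m M^T) *m x) 0 0 = sqnorm (M^T *m x).
  by rewrite -sqnormE trmx_mul trmxK !mulmxA.
have -> : sqnorm x = ((M^T *m x)^T *m (M^T *m z)) 0 0.
  by rewrite -sqnormE -{2}Wz trmx_mul trmxK !mulmxA.
exact: cauchy_schwarz.
Qed.

Lemma quadratic_form_bound n (W : 'M[R]_n) (x : 'cV[R]_n) :
  (x^T *m W *m x) 0 0 <= (\sum_i \sum_j `|W i j|) * sqnorm x.
Proof.
have -> : (x^T *m W *m x) 0 0 = \sum_i \sum_j W i j * (x i 0 * x j 0).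
  rewrite mxE exchange_big; apply: eq_bigr => j _ /=.
  rewrite mxE mulr_suml; apply: eq_bigr => i _; rewrite !mxE; ring.
rewrite mulr_suml; apply: ler_sum => i _; rewrite mulr_suml; apply: ler_sum => j _.
apply: (le_trans (ler_norm _)); rewrite normrM ler_wpM2l//.
have xn k : x k 0 ^+ 2 <= sqnorm x.
  by rewrite /sqnorm (bigD1 k)//= lerDl sumr_ge0// => l _; exact: sqr_ge0.
have := xn i; have := xn j; have := sqr_ge0 (x i 0 - x j 0); have := sqr_ge0 (x i 0 + x j 0).
by rewrite ler_norml => *; apply/andP; split; nra.
Qed.

End linear_algebra.

(** * Gram structure of the covariance and weight matrices *)

Section model.
Context {R : realType} (p : nat).

Lemma tensmx11 n : tensmx (1%:M : 'M[R]_n) (1%:M : 'M[R]_n) = 1%:M.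
Proof.
apply/matrixP => i j; case: (mxtens_indexP i) => a b; case: (mxtens_indexP j) => a' b'.
rewrite tensmxE !mxE (can_eq (@mxtens_indexK _ _)) xpair_eqE.
by case: (a == a'); case: (b == b'); rewrite ?mulr1 ?mulr0.
Qed.

(** [unvech] sees [v] only through [dup_mx R p *m v], and [vech] recovers [v] from [unvech v]. *)
Lemma dup_mx_inj (v : 'cV[R]_(pbar p)) : dup_mx R p *m v = 0 -> v = 0.
Proof.
move=> Dv; rewrite -[v]unvechK /unvech Dv; apply/matrixP => k j; rewrite !mxE.
have [|kp] := ltnP k (size (vech_pairs p)); last by rewrite nth_default// size_map.
case E : (vech_pairs p) => [//|x0 s] kp; rewrite -E in kp *.
by rewrite (nth_map x0)// !mxE.
Qed.

Lemma dup_gram_unitmx : (dup_mx R p)^T *m dup_mx R p \in unitmx.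
Proof.
rewrite -{2}[dup_mx R p]trmxK; apply: gram_unitmx => v /(congr1 trmx).
rewrite trmx_mul trmxK trmx0 => /dup_mx_inj /(congr1 trmx).
by rewrite trmxK trmx0.
Qed.

(** The position is the same for all [A], which reduces continuity, measurability and closeness of
    half-vectorizations to those of matrix entries. *)
Lemma vech_entry k : exists ij : 'I_p * 'I_p, forall A : 'M[R]_p,
  vech A k 0 = A ij.1 ij.2.
Proof.
have kp : (k < size (vech_pairs p))%N by rewrite size_vech_pairs.
case E : (vech_pairs p) => [|x0 s]; first by move: kp; rewrite E.
exists (nth x0 (vech_pairs p) k) => A; by rewrite !mxE (nth_map x0).
Qed.

Section parameter.
Variables (m r : nat) (th : 'cV[R]_(qdim p m)) (S : 'M[R]_(m, r)).
Hypothesis SffE : Sff th = S *m S^T.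
Hypothesis sigma2_ge0 : forall i, 0 <= sigma2 th i 0.

(* The diffusion coefficient of the observations with respect to [col_mx W B]. *)
Definition diffusion : 'M[R]_(p, r + p) :=
  row_mx (Lambda th *m S) (diag_mx (\row_i sigma th i)).

Lemma Sigma_gram : Sigma th = diffusion *m diffusion^T.
Proof.
rewrite /diffusion tr_row_mx mul_row_col trmx_mul mulmxA /Sigma SffE !mulmxA.
congr (_ + _); rewrite tr_diag_mx mulmx_diag; congr diag_mx.
by apply/rowP => i; rewrite [LHS]mxE [RHS]mxE ![(\row__ _) _ _]mxE -expr2 sqr_sqrtr.
Qed.

Lemma Sigma_sym : (Sigma th)^T = Sigma th.
Proof. by rewrite Sigma_gram trmx_mul trmxK. Qed.

Hypothesis sigma_gt0 : forall i, 0 < sigma th i.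

(** The diagonal block of [diffusion], with positive entries, alone makes it injective on row
    vectors. *)
Lemma Sigma_unitmx : Sigma th \in unitmx.
Proof.
rewrite Sigma_gram; apply: gram_unitmx => v.
rewrite mul_mx_row -[0](row_mx0) => /eq_row_mx[_ vs].
apply/rowP => i; have := congr1 (fun w : 'rV_p => w 0 i) vs.
rewrite mul_mx_diag !mxE => /eqP; rewrite mulf_eq0 => /orP[/eqP//|].
by rewrite gt_eqF.
Qed.

(** A rectangular square root of the weight matrix, available because the Kronecker square of
    [diffusion *m diffusion^T] is itself a Gram matrix. *)
Definition Wroot : 'M[R]_(pbar p, (r + p) * (r + p)) :=
  Num.sqrt 2 *: (dup_pinv R p *m tensmx diffusion diffusion).

Lemma Wmx_gram : Wmx th = Wroot *m Wroot^T.
Proof.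
rewrite /Wroot /Wmx linearZ/= -scalemxAl -scalemxAr scalerA -expr2 sqr_sqrtr//.
rewrite Sigma_gram -tensmx_mul -trmx_tens.
by rewrite (trmx_mul (dup_pinv R p) (tensmx diffusion diffusion)) !mulmxA.
Qed.

Lemma Wmx_unitmx : Wmx th \in unitmx.
Proof.
rewrite Wmx_gram; apply: gram_unitmx => v.
rewrite /Wroot -scalemxAr => /(congr1 (fun A => (Num.sqrt 2)^-1 *: A)).
rewrite scalerA mulVf ?gt_eqF ?sqrtr_gt0// scale1r scaler0 mulmxA.
(* Completing to the Kronecker square of [Sigma th] allows it to be inverted factorwise, leaving
   [v *m dup_pinv R p = 0]; its transpose is a kernel equation for the injective [dup_mx]. *)
move=> /(congr1 (fun A => A *m (tensmx diffusion diffusion)^T)).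
rewrite /= mul0mx -(mulmxA (v *m dup_pinv R p)) trmx_tens tensmx_mul -Sigma_gram.
move=> /(congr1 (fun A => A *m tensmx (invmx (Sigma th)) (invmx (Sigma th)))).
rewrite /= mul0mx -(mulmxA (v *m dup_pinv R p)) tensmx_mul mulmxV ?Sigma_unitmx// tensmx11.
rewrite mulmx1 /dup_pinv mulmxA => /(congr1 trmx).
rewrite trmx_mul trmxK trmx0 => /dup_mx_inj.
move=> /(congr1 trmx); rewrite trmxK trmx0.
move=> /(congr1 (fun A => A *m ((dup_mx R p)^T *m dup_mx R p))).
by rewrite mulmxKV ?dup_gram_unitmx// mul0mx.
Qed.

Lemma contrast_ge0 (v : 'cV[R]_(pbar p)) : 0 <= contrast v th.
Proof.
have := Wmx_unitmx; rewrite /contrast Wmx_gram => Wu.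
by rewrite gram_inverse_form// sqnorm_ge0.
Qed.

(** The common factor [sqnorm] is kept on both sides, so that the estimate also covers a vanishing
    residual without a case split. *)
Lemma contrast_bound (v : 'cV[R]_(pbar p)) :
  sqnorm (v - vech (Sigma th)) ^+ 2 <=
  (\sum_i \sum_j `|Wmx th i j|) * sqnorm (v - vech (Sigma th)) * contrast v th.
Proof.
have := Wmx_unitmx; rewrite Wmx_gram => Wu.
apply: (le_trans (gram_inverse_bound (v - vech (Sigma th)) Wu)); rewrite -Wmx_gram.
by apply: ler_wpM2r; [exact: contrast_ge0|exact: quadratic_form_bound].
Qed.

End parameter.
End model.

(** * Uniform lower bound and measurability *)

Section entry_continuity.
Context {R : realType} {U : topologicalType}.

Definition entry_continuous (a b : nat) (F : U -> 'M[R]_(a, b)) :=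
  forall i j, continuous (fun x => F x i j).

Lemma continuous_sum_entry (I : finType) (f : I -> U -> R) :
  (forall i, continuous (f i)) -> continuous (fun x => \sum_i f i x).
Proof. by move=> cf; apply: continuous_big => //; exact: add_continuous. Qed.

Lemma entry_continuous_cst a b (A : 'M[R]_(a, b)) : entry_continuous (fun=> A).
Proof. by move=> i j x; exact: cvg_cst. Qed.

Lemma entry_continuousD a b (F G : U -> 'M[R]_(a, b)) :
  entry_continuous F -> entry_continuous G -> entry_continuous (fun x => F x + G x).
Proof.
move=> cF cG i j; rewrite (_ : (fun x => _) = (fun x => F x i j + G x i j)).
  by move=> x; apply: cvgD; [exact: cF|exact: cG].
by apply/funext => x; rewrite mxE.
Qed.

Lemma entry_continuousZ a b (c : R) (F : U -> 'M[R]_(a, b)) :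
  entry_continuous F -> entry_continuous (fun x => c *: F x).
Proof.
move=> cF i j; rewrite (_ : (fun x => _) = (fun x => c * F x i j)).
  by move=> x; apply: cvgM; [exact: cvg_cst|exact: cF].
by apply/funext => x; rewrite mxE.
Qed.

Lemma entry_continuousT a b (F : U -> 'M[R]_(a, b)) :
  entry_continuous F -> entry_continuous (fun x => (F x)^T).
Proof.
move=> cF i j; rewrite (_ : (fun x => _) = (fun x => F x j i)); first exact: cF.
by apply/funext => x; rewrite mxE.
Qed.

Lemma entry_continuousM a b c (F : U -> 'M[R]_(a, b)) (G : U -> 'M[R]_(b, c)) :
  entry_continuous F -> entry_continuous G -> entry_continuous (fun x => F x *m G x).
Proof.
move=> cF cG i j; rewrite (_ : (fun x => _) = (fun x => \sum_k F x i k * G x k j)).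
  by apply: continuous_sum_entry => k x; apply: cvgM; [exact: cF|exact: cG].
by apply/funext => x; rewrite mxE.
Qed.

Lemma entry_continuous_tens a b a' b' (F : U -> 'M[R]_(a, b)) (G : U -> 'M[R]_(a', b')) :
  entry_continuous F -> entry_continuous G -> entry_continuous (fun x => tensmx (F x) (G x)).
Proof.
move=> cF cG i j; rewrite (_ : (fun x => _) = (fun x =>
  F x (mxtens_unindex i).1 (mxtens_unindex j).1 * G x (mxtens_unindex i).2 (mxtens_unindex j).2)).
  by move=> x; apply: cvgM; [exact: cF|exact: cG].
by apply/funext => x; rewrite mxE.
Qed.

Lemma entry_continuous_unvec a b (v : U -> 'cV[R]_(b * a)) :
  entry_continuous v -> entry_continuous (fun x => @unvec R a b (v x)).
Proof.
move=> cv i j; rewrite (_ : (fun x => _) = (fun x => v x (mxtens_index (j, i)) 0)).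
  exact: cv.
by apply/funext => x; rewrite mxE.
Qed.

End entry_continuity.

Section model_continuity.
Context {R : realType} (p m : nat).
Hypothesis mp : (m <= p)%N.
Local Notation param := 'cV[R]_(qdim p m).

Lemma Lambda_continuous : entry_continuous (fun th : param => Lambda th).
Proof.
move=> i j; rewrite (_ : (fun th => _) = (fun th : param =>
    col_mx 1%:M (loadA th) (cast_ord (esym (subnKC mp)) i) (cast_ord (esym erefl) j))).
  move: (cast_ord _ i) (cast_ord _ j) => {}i {}j.
  case: (split_ordP i) => i' ->.
    rewrite (_ : (fun th => _) = cst ((1%:M : 'M[R]_m) i' j)).
      exact: cst_continuous.
    by apply/funext => th; rewrite col_mxEu.
  rewrite (_ : (fun th => _) = (fun th : param => loadA th i' j)).
    apply: entry_continuous_unvec => a b.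
    rewrite (_ : (fun th => _) = (fun th : param => th (lshift _ (lshift _ a)) b)).
      exact: coord_continuous.
    by apply/funext => th; rewrite !mxE.
  by apply/funext => th; rewrite col_mxEd.
by apply/funext => th; rewrite (Lambda_cast mp) castmxE.
Qed.

Lemma Sigma_continuous : entry_continuous (fun th : param => Sigma th).
Proof.
apply: entry_continuousD.
  apply: entry_continuousM; last by apply: entry_continuousT; exact: Lambda_continuous.
  apply: entry_continuousM; first exact: Lambda_continuous.
  apply: entry_continuous_unvec; apply: entry_continuousM; first exact: entry_continuous_cst.
  move=> a b; rewrite (_ : (fun th => _) = (fun th : param => th (lshift _ (rshift _ a)) b)).
    exact: coord_continuous.
  by apply/funext => th; rewrite !mxE.
move=> i j; rewrite (_ : (fun th => _) = (fun th : param => th (rshift _ i) 0 *+ (i == j))).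
  by case: (i == j); [exact: coord_continuous|exact: cst_continuous].
by apply/funext => th; rewrite !mxE.
Qed.

Lemma Wmx_continuous : entry_continuous (fun th : param => Wmx th).
Proof.
apply: entry_continuousZ; apply: entry_continuousM; last exact: entry_continuous_cst.
apply: entry_continuousM; first exact: entry_continuous_cst.
by apply: entry_continuous_tens; exact: Sigma_continuous.
Qed.

Lemma contrast_continuous (th : param) : continuous (fun v : 'cV[R]_(pbar p) => contrast v th).
Proof.
have cx : entry_continuous (fun v : 'cV[R]_(pbar p) => v - vech (Sigma th)).
  apply: entry_continuousD; last exact: entry_continuous_cst.
  by move=> i j; exact: coord_continuous.
suff : entry_continuous (fun v : 'cV[R]_(pbar p) =>
    (v - vech (Sigma th))^T *m invmx (Wmx th) *m (v - vech (Sigma th))) by exact.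
apply: entry_continuousM => //; apply: entry_continuousM; last exact: entry_continuous_cst.
exact: entry_continuousT.
Qed.

Lemma sqnorm_continuous (v0 : 'cV[R]_(pbar p)) :
  continuous (fun th : param => sqnorm (v0 - vech (Sigma th))).
Proof.
apply: continuous_sum_entry => k; have [ij vE] := @vech_entry R p k.
rewrite (_ : (fun th => _) = (fun th : param => (v0 k 0 - Sigma th ij.1 ij.2) *
    (v0 k 0 - Sigma th ij.1 ij.2))).
  have cS : continuous (fun th : param => v0 k 0 - Sigma th ij.1 ij.2).
    have cS0 : continuous (fun th : param => Sigma th ij.1 ij.2) by exact: Sigma_continuous.
    by move=> th; apply: (@continuousB _ _ _ (cst (v0 k 0))); [exact: cst_continuous|exact: cS0].
  by move=> th; exact: (cvgM (cS th) (cS th)).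
by apply/funext => th; rewrite -vE -expr2 2!mxE.
Qed.

(* By compactness the inverse weight matrices are uniformly bounded below and [v0]
   stays at positive distance from the model. *)
Lemma contrast_lower_bound (r : nat) (Theta : set param) (v0 : 'cV[R]_(pbar p)) :
  Theta !=set0 -> compact Theta ->
  (forall th, Theta th -> [/\ exists S : 'M[R]_(m, r), Sff th = S *m S^T,
     forall i, 0 <= sigma2 th i 0 & forall i, 0 < sigma th i]) ->
  (forall th, Theta th -> v0 <> vech (Sigma th)) ->
  exists eps c : R, [/\ 0 < eps, 0 < c & forall v : 'cV[R]_(pbar p), (forall k, `|v k 0 - v0 k 0| < eps) ->
    forall th, Theta th -> c <= contrast v th].
Proof.
move=> T0 cT Tpar Tv0.
have cW : continuous (fun th : param => \sum_i \sum_j `|Wmx th i j|).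
  apply: continuous_sum_entry => i; apply: continuous_sum_entry => j th.
  have cWij : continuous (fun th : param => Wmx th i j) by exact: Wmx_continuous.
  exact: (cvg_norm (cWij th)).
have [th1 _ W1] := compact_EVT_max T0 cT (continuous_subspaceT cW).
have cN : continuous (fun th : param => sqnorm (v0 - vech (Sigma th))) by exact: sqnorm_continuous.
have [th2] := compact_EVT_min T0 cT (continuous_subspaceT cN).
rewrite inE => Tth2 N2.
have [K W2] : exists K, forall th, Theta th -> \sum_i \sum_j `|Wmx th i j| <= K.
  by exists (\sum_i \sum_j `|Wmx th1 i j|) => th Tth; exact: W1 (mem_set Tth).
set N0 := sqnorm _ in N2.
have N00 : 0 < N0.
  rewrite lt0r sqnorm_ge0 andbT; apply/eqP => /sqnorm_eq0 /eqP.
  by rewrite subr_eq0 => /eqP; exact: Tv0.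
have K0 : 0 <= K by apply: le_trans (W2 _ Tth2); do 2 (apply: sumr_ge0 => ? _).
(* As eps <= 1, each squared deviation is at most eps, and the [pbar p] of them sum to at most N0 /
   4. The successor here and K + 1 below keep the denominators positive. *)
pose eps := Num.min 1 (N0 / (4 * (pbar p).+1%:R)).
have eps0 : 0 < eps by rewrite lt_min ltr01/= divr_gt0// mulr_gt0.
exists eps, (N0 / (4 * (K + 1))); split=> //.
  by rewrite divr_gt0// mulr_gt0// ltr_wpDl.
move=> v vv0 th Tth; have [[S SE] s2 s1] := Tpar _ Tth.
have hb := contrast_bound SE s2 s1 v; have c0 := contrast_ge0 SE s2 s1 v.
set N := sqnorm _ in hb.
(* From (a + b)^2 <= 2 a^2 + 2 b^2; with [epsN] it leaves N >= N0 / 4 for every parameter in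
   [Theta]. *)
have NN : N0 <= 2 * N + 2 * sqnorm (v - v0).
  apply: (le_trans (N2 th (mem_set Tth))).
  rewrite /N /sqnorm !mulr_sumr -big_split/=; apply: ler_sum => k _.
  rewrite !mxE; set a := v k 0; set b := v0 k 0; set s := _`_k.
  have := sqr_ge0 ((a - s) + (a - b)); lra.
have epsN : sqnorm (v - v0) <= N0 / 4.
  apply: (@le_trans _ _ (\sum_(k < pbar p) eps)).
    apply: ler_sum => k _; rewrite !mxE -(real_normK (num_real _)).
    have := vv0 k; have : eps <= 1 by rewrite /eps ge_min lexx.
    have := normr_ge0 (v k 0 - v0 k 0); nra.
  rewrite sumr_const card_ord -(mulr_natl eps).
  apply: (@le_trans _ _ ((pbar p).+1%:R * (N0 / (4 * (pbar p).+1%:R)))).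
    by apply: ler_pM; rewrite ?ler_nat ?(ltW eps0)// /eps ge_min lexx orbT.
  have := ltr0Sn R (pbar p); move: ((pbar p).+1%:R) => X X0.
  by rewrite le_eqVlt; apply/orP; left; apply/eqP; field; rewrite gt_eqF.
have N4 : N0 / 4 <= N by lra.
have N_gt0 : 0 < N by lra.
have WK := W2 _ Tth.
clear NN; move: hb WK c0 N_gt0 N4; move: (\sum_i \sum_j `|Wmx th i j|) (contrast v th) N.
move=> w q N hb WK q0 N_gt0 N4.
have NK : N <= K * q.
  rewrite -(ler_pM2l N_gt0) -expr2 (le_trans hb)// mulrA (mulrC N K).
  by rewrite ler_wpM2r// ler_wpM2r// ltW.
rewrite ler_pdivrMr ?mulr_gt0// ?ltr_wpDl//.
apply: (@le_trans _ _ (4 * (K * q))); first by lra.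
by rewrite (mulrC q) -mulrA ler_pM2l// ler_wpM2r// lerDl.
Qed.

End model_continuity.

Section measurable_minimum.
Context d (Omega : measurableType d) (R : realType) (n : nat).
Variable v : Omega -> 'cV[R]_n.
Hypothesis mv : forall i, measurable_fun setT (fun om => v om i 0).

Let natSinv_lt (e : R) : 0 < e -> exists k : nat, k.+1%:R^-1 < e.
Proof.
move=> e0; have [N _ /(_ N (leqnn N)) /= ?] := near_infty_natSinv_lt (PosNum e0).
by exists N.
Qed.

(** Measurability is known coordinatewise only; an open set is the countable union of the cubes with
    rational centre and radius 1 / (k + 1) that it contains. *)
Lemma measurable_open_preimage (O : set 'cV[R]_n) : open O -> measurable (v @^-1` O).
Proof.
move=> oO.
pose cube (qk : 'cV[rat]_n * nat) : set 'cV[R]_n :=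
  [set x | forall i, `|ratr (qk.1 i 0) - x i 0| < qk.2.+1%:R^-1].
have -> : v @^-1` O = \bigcup_(qk in [set qk | cube qk `<=` O]) v @^-1` cube qk.
  apply/seteqP; split=> [om /= Ov|om [qk /= sub /sub]//].
  move: oO; rewrite openE => /(_ _ Ov) /nbhs_ballP[e /= e0 eO].
  (* Half the radius: the point and any other element of the cube are each within 1 / (k + 1) of the
     rational centre. *)
  have [k ke] : exists k : nat, k.+1%:R^-1 < e / 2 by apply: natSinv_lt; rewrite divr_gt0.
  have /choice[q qP] (i : 'I_n) : exists q : rat, `|ratr q - v om i 0| < k.+1%:R^-1.
    have /rat_in_itvoo[q] : v om i 0 - k.+1%:R^-1 < v om i 0 + k.+1%:R^-1.
      have k0 : 0 < k.+1%:R^-1 :> R by rewrite invr_gt0 ltr0n.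
      by rewrite ltrBlDr -addrA ltrDl addr_gt0.
    by rewrite in_itv/= => h; exists q; rewrite ltr_distl.
  exists ((\col_i q i), k) => [x xq|i /=]; last by rewrite mxE.
  apply: eO; split=> // i j; rewrite (ord1 j) /ball/=.
  have h1 := xq i; have h2 := qP i; rewrite /= mxE in h1; rewrite distrC in h2.
  have h3 := ler_distD (ratr (q i)) (v om i 0) (x i 0).
  by move: (k.+1%:R^-1) ke h1 h2 h3 => K; lra.
rewrite bigcup_mkcond; apply: countable_bigcupT_measurable => // -[q k].
case: ifP => // _; rewrite (_ : _ @^-1` _ = \bigcap_(i in [set: 'I_n])
    [set om | `|ratr (q i 0) - v om i 0| < k.+1%:R^-1]); last first.
  by apply/seteqP; split=> om /= h i; [move=> _|]; exact: h.
apply: fin_bigcap_measurable => // i _.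
rewrite (_ : [set _ | _] = ~` [set om | k.+1%:R^-1 <= `|ratr (q i 0) - v om i 0|]).
  apply: measurableC; rewrite -[X in measurable X]setTI.
  apply: measurable_fun_le => //; apply: measurableT_comp => //.
  exact: measurable_funB.
by apply/seteqP; split=> om /=; rewrite ltNge => /negP.
Qed.

(* The minimizer [x] itself need not be measurable; the minimal value is upper
   semicontinuous in [v]. *)
Lemma measurable_min_gt (V : Type) (Theta : set V) (g : 'cV[R]_n -> V -> R)
    (x : Omega -> V) (a : R) :
  (forall th, continuous (g ^~ th)) ->
  (forall om, is_minimizer Theta (g (v om)) (x om)) ->
  measurable [set om | a < g (v om) (x om)].
Proof.
move=> cg xmin.
(* The minimum is at most [a] exactly when for every k some parameter has value below a + 1 / (k +
   1). The slack makes each condition open in [v], even as an uncountable union over [Theta]. *)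
have -> : [set om | a < g (v om) (x om)] =
    ~` (\bigcap_k v @^-1` (\bigcup_(th in Theta) [set w | g w th < a + k.+1%:R^-1])).
  apply/seteqP; split=> om /=.
    move=> ax h; have [k ke] := natSinv_lt (etrans (subr_gt0 a (g (v om) (x om))) ax).
    have [th Tth /= gth] := h k I; have := (xmin om).2 _ Tth.
    by move: (k.+1%:R^-1) ke gth => K; lra.
  move=> h; rewrite ltNge; apply/negP => xa; apply: h => k _.
  exists (x om); first by have [] := xmin om.
  by rewrite /= (le_lt_trans xa)// ltrDl invr_gt0.
apply: measurableC; apply: bigcapT_measurable => k.
apply: measurable_open_preimage; apply: bigcup_open => th _.
apply: (@open_comp _ _ (g ^~ th) [set y | y < a + k.+1%:R^-1]); last exact: open_lt.
by move=> w _; exact: cg.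
Qed.

End measurable_minimum.

(** * The test under the alternative *)

Section noise.
Context d (Omega : measurableType d) (R : realType) (P : probability Omega R).

Lemma mutually_independent_pair (I : finType) (G : I -> set (set Omega)) i j E F :
  mutually_independent P G -> i != j -> G i E -> G j F ->
  P (E `&` F) = (P E * P F)%E.
Proof.
move=> ind ij GE GF.
have := ind [set i; j]%SET (fun l => if l == i then E else F).
rewrite big_setU1 ?inE// big_set1 eqxx eq_sym (negbTE ij) => <-.
  congr (P _); apply/seteqP; split=> om.
    by move=> [Eo Fo] l _; case: eqP.
  move=> h; split.
    by have := h i; rewrite eqxx; apply; rewrite /= !inE eqxx.
  by have := h j; rewrite eq_sym (negbTE ij); apply; rewrite /= !inE eqxx orbT.
move=> l; rewrite !inE => /orP[/eqP->|/eqP->]; first by rewrite eqxx.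
by rewrite eq_sym (negbTE ij).
Qed.

Lemma gen_sigma_sub (I J : Type) (D : set I) (Z : I -> Omega -> R) (D' : set J)
    (Z' : J -> Omega -> R) (phi : I -> J) :
  (forall i, D i -> D' (phi i)) -> (forall i, Z i = Z' (phi i)) ->
  gen_sigma D Z `<=` gen_sigma D' Z'.
Proof.
move=> DD ZZ; rewrite /gen_sigma; apply: sub_smallest2r; first exact: smallest_sigma_algebra.
by move=> E [i Di [A mA ->]]; exists (phi i); [exact: DD|exists A; rewrite ?ZZ].
Qed.

Variables (p r : nat) (W : R -> Omega -> 'cV[R]_r) (B : R -> Omega -> 'cV[R]_p).
Hypothesis W_wiener : wiener_vec P W.
Hypothesis B_wiener : forall i, wiener P (fun t om => B t om i 0).
Hypothesis WB_indep : mutually_independent P (sigma_noise W B).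

Let V t om := col_mx (W t om) (B t om).

Let Vl j : (fun t om => V t om (lshift p j) 0) = (fun t om => W t om j 0).
Proof. by apply/funext => t; apply/funext => om; rewrite /V col_mxEu. Qed.

Let Vr i : (fun t om => V t om (rshift r i) 0) = (fun t om => B t om i 0).
Proof. by apply/funext => t; apply/funext => om; rewrite /V col_mxEd. Qed.

Lemma joint_wiener a : wiener P (fun t om => V t om a 0).
Proof.
case: (split_ordP a) => j ->; last by rewrite Vr.
by rewrite Vl; exact: W_wiener.1.
Qed.

Let sigma_W j E : gen_sigma `[0, +oo[ (fun t om => W t om j 0) E ->
  sigma_noise W B None E.
Proof.
apply: (@gen_sigma_sub _ _ _ _ _ _ (fun t => (t, j))) => // t.
by rewrite /= in_itv/= andbT.
Qed.

(** Two components of [W] are independent by [wiener_vec]; in the other cases [WB_indep] applies, a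
    component of [W] being measurable for the sigma-algebra of the whole vector, indexed by
    [None]. *)
Lemma joint_wiener_independent a b : a != b -> forall E F,
  gen_sigma `[0, +oo[ (fun t om => V t om a 0) E ->
  gen_sigma `[0, +oo[ (fun t om => V t om b 0) F ->
  P (E `&` F) = (P E * P F)%E.
Proof.
case: (split_ordP a) => i ->; case: (split_ordP b) => j ->; rewrite ?Vl ?Vr => ab E F hE hF.
- have ij : i != j by apply: contra ab => /eqP->.
  exact: (mutually_independent_pair W_wiener.2 ij hE hF).
- exact: (mutually_independent_pair WB_indep (i := None) (j := Some j) _ (sigma_W hE) hF).
- exact: (mutually_independent_pair WB_indep (i := Some i) (j := None) _ hE (sigma_W hF)).
- have ij : Some i != Some j by apply: contra ab => /eqP[->].
  exact: (mutually_independent_pair WB_indep ij hE hF).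
Qed.

End noise.

Lemma is_minimizerZ (R : numDomainType) (U : Type) (Theta : set U) (g : U -> R) (x : U)
  (a : R) : 0 <= a -> is_minimizer Theta g x -> is_minimizer Theta (fun y => a * g y) x.
Proof. by move=> a0 [Tx gx]; split=> // y Ty; rewrite ler_wpM2l// gx. Qed.

Theorem theorem8 (R : realType) (d : measure_display)
  (Omega : measurableType d) (P : probability Omega R)
  (p r k ks : nat) (T alpha : R)
  (p_ge2 : (2 <= p)%N) (r_ge1 : (1 <= r)%N)
  (k_bnd : (1 <= k < p)%N) (ks_bnd : (1 <= ks < p)%N)
  (T_gt0 : 0 < T)
  (df_pos : (qdim p ks < pbar p)%N)
  (alpha_bnd : 0 < alpha <= 1)
  (* alternative hypothesis *)
  (H1 : k <> ks)
  (* parameter spaces and true parameter *)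
  (Thetak : set 'cV[R]_(qdim p k)) (Thetaks : set 'cV[R]_(qdim p ks))
  (Thetak_space : param_space r Thetak)
  (Thetaks_space : param_space r Thetaks)
  (th0 : 'cV[R]_(qdim p k)) (th0_int : interior Thetak th0)
  (S0 : 'M[R]_(k, r)) (S0_eq : Sff th0 = S0 *m S0^T)
  (* driving noises *)
  (W : R -> Omega -> 'cV[R]_r) (B : R -> Omega -> 'cV[R]_p)
  (W_wiener : wiener_vec P W)
  (B_wiener : forall i, wiener P (fun t om => B t om i 0))
  (WB_indep : mutually_independent P (sigma_noise W B))
  (* factor and error processes, observations *)
  (bk : 'cV[R]_k -> 'cV[R]_k) (Be : 'I_p -> R -> R)
  (c1 : 'cV[R]_k) (c2 : 'cV[R]_p)
  (f : R -> Omega -> 'cV[R]_k) (e X : R -> Omega -> 'cV[R]_p)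
  (f_sde : sde_solution P T bk S0 W c1 f)
  (e_sde : sde_solution P T (fun y : 'cV[R]_p => \col_i Be i (y i 0))
             (diag_mx (\row_i sigma th0 i)) B c2 e)
  (X_def : forall t om, 0 <= t <= T -> X t om = Lambda th0 *m f t om + e t om)
  (* (i) *)
  (bk_lip : exists2 C : R, 0 < C &
     forall x y, enorm (bk x - bk y) <= C * enorm (x - y))
  (f_mom : bounded_moments P T f)
  (bk_C4 : forall j, C4up (fun x => bk x j 0))
  (* (ii) *)
  (Be_lip : exists2 C : R, 0 < C &
     forall i x y, `|Be i x - Be i y| <= C * `|x - y|)
  (e_mom : bounded_moments P T e)
  (Be_C4 : forall i, C4up (fun x : 'cV[R]_1 => Be i (x 0 0)))
  (* (iii) *)
  (sigk_gt0 : forall th, Thetak th -> forall i, 0 < sigma th i)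
  (sigks_gt0 : forall th, Thetaks th -> forall i, 0 < sigma th i)
  (* (iv) *)
  (Delta_rank : \rank (Delta th0) = qdim p k)
  (* (v) *)
  (thbar : 'cV[R]_(qdim p ks))
  (thbar_min : is_minimizer Thetaks (contrast (vech (Sigma th0))) thbar)
  (thbar_id : forall th, Thetaks th ->
     contrast (vech (Sigma th0)) th = contrast (vech (Sigma th0)) thbar ->
     th = thbar)
  (* (vi) *)
  (misspec : Sigma th0 <> Sigma thbar)
  (* the estimator *)
  (thhat : nat -> Omega -> 'cV[R]_(qdim p ks))
  (thhat_min : forall n om, (0 < n)%N ->
     is_minimizer Thetaks (contrast (vech (QXX T X n om))) (thhat n om)) :
  P [set om | chi2_upper (pbar p - qdim p ks) alpha
              < n%:R * contrast (vech (QXX T X n om)) (thhat n om)]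
    @[n --> \oo] --> 1%E.
Proof.
have ksp : (ks <= p)%N by case/andP: ks_bnd => _ /ltnW.
have Tth0 : Thetak th0 by exact: interior_subset th0_int.
have [_ _ /(_ _ Tth0)[_ s20]] := Thetak_space.
pose G := diffusion th0 S0; have GG : Sigma th0 = G *m G^T by exact: Sigma_gram.
pose V t om := col_mx (W t om) (B t om).
have ks_par th : Thetaks th -> [/\ exists S : 'M[R]_(ks, r), Sff th = S *m S^T,
    forall i, 0 <= sigma2 th i 0 & forall i, 0 < sigma th i].
  move=> Tth; have [_ _ /(_ _ Tth)[? ?]] := Thetaks_space.
  by split=> //; exact: sigks_gt0.
have X_path : {ae P, forall om, exists K : R, forall s t, 0 <= s -> s <= t -> t <= T ->
    forall u, `|X t om u 0 - X s om u 0 - (G *m (V t om - V s om)) u 0| <= K * (t - s)}.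
  have cb i : continuous (fun x => bk x i 0) by have [] := bk_C4 i [::] isT.
  have ce i : continuous (fun y : 'cV[R]_p => (\col_j Be j (y j 0)) i 0).
    rewrite (_ : (fun y => _) = fun y : 'cV[R]_p => Be i (y i 0)); last first.
      by apply/funext => y; rewrite mxE.
    (* [C4up] is stated for functions of a one-entry column; continuity on the scalars is read off
       the Lipschitz bound. *)
    have cBe : continuous (Be i).
      have [C C0 lip] := Be_lip; move=> x; apply/cvgrPdist_lt => eps eps0.
      near=> z; apply: (le_lt_trans (lip i x z)); rewrite mulrC -ltr_pdivlMr//.
      by near: z; apply: cvgr_dist_lt; rewrite ?divr_gt0.
    move=> y; apply: (@continuous_comp _ _ _ (fun y : 'cV[R]_p => y i 0) (Be i)).
      exact: coord_continuous.
    exact: cBe.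
  have := sde_increment_bound T_gt0 f_sde cb.
  apply: filterS2 (sde_increment_bound T_gt0 e_sde ce) => om [Ke he] [Kf hf].
  (* Summing over all rows of the loading matrix gives one constant valid for every coordinate
     [u]. *)
  exists (\sum_u \sum_j `|Lambda th0 u j| * `|Kf| + Ke) => s t s0 st tT u.
  rewrite !X_def ?s0 ?(le_trans s0 st) ?tT ?(le_trans st tT)//.
  have -> : (Lambda th0 *m f t om + e t om) u 0 - (Lambda th0 *m f s om + e s om) u 0 -
      (G *m (V t om - V s om)) u 0 =
    (Lambda th0 *m (f t om - f s om - S0 *m (W t om - W s om))) u 0 +
    (e t om u 0 - e s om u 0 - (diag_mx (\row_i sigma th0 i) *m (B t om - B s om)) u 0).
    rewrite /V opp_col_mx add_col_mx /G /diffusion mul_row_col -mulmxA.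
    rewrite !mulmxBr !mxE; ring.
  rewrite mulrDl; apply: (le_trans (ler_normD _ _)); apply: lerD; last exact: he.
  rewrite mxE; apply: (le_trans (ler_norm_sum _ _ _)).
  rewrite (bigD1 u)//= mulrDl mulr_suml; apply: ler_wpDr.
    rewrite mulr_ge0 ?subr_ge0//; do 2 (apply: sumr_ge0 => ? _); exact: mulr_ge0.
  apply: ler_sum => j _; rewrite normrM -mulrA ler_wpM2l//.
  have hj := hf s t s0 st tT j; rewrite !mxE in hj *.
  by apply: (le_trans hj); rewrite ler_wpM2r ?subr_ge0// ler_norm.
have mX t : 0 <= t <= T -> forall u, measurable_fun setT (fun om => X t om u 0).
  move=> tT u; rewrite (_ : (fun om => _) =
      fun om => \sum_j Lambda th0 u j * f t om j 0 + e t om u 0); last first.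
    by apply/funext => om; rewrite X_def// !mxE.
  apply: measurable_funD; last exact: e_sde.1.
  by apply: measurable_sum => j; apply: measurable_funM => //; exact: f_sde.1.
(* A parameter reproducing the true covariance would make the minimal contrast zero, hence zero at
   [thbar], where [contrast_bound] forces [Sigma thbar = Sigma th0], against misspecification. *)
have v0_out th : Thetaks th -> vech (Sigma th0) <> vech (Sigma th).
  move=> Tth v0E; apply: misspec.
  have [[Sb SbE] sb2 sb] := ks_par _ thbar_min.1.
  have c0 : contrast (vech (Sigma th0)) th = 0.
    by rewrite /contrast v0E subrr mulmx0 mxE.
  have := thbar_min.2 _ Tth; rewrite c0 => cb0.
  have cb : contrast (vech (Sigma th0)) thbar = 0.
    by apply/eqP; rewrite eq_le cb0 (contrast_ge0 SbE).
  have := contrast_bound SbE sb2 sb (vech (Sigma th0)); rewrite cb mulr0.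
  move=> N0; have /sqnorm_eq0 /eqP : sqnorm (vech (Sigma th0) - vech (Sigma thbar)) = 0.
    by apply/eqP; rewrite -sqrf_eq0 eq_le N0 sqr_ge0.
  rewrite subr_eq0 => /eqP/(congr1 (@unvech R p)).
  by rewrite !unvech_vech ?(Sigma_sym SbE sb2) ?(Sigma_sym S0_eq s20).
have [eps [c [eps0 c0 lb]]] := contrast_lower_bound ksp
  (ex_intro _ thbar thbar_min.1) (let: And3 _ h _ := Thetaks_space in h) ks_par v0_out.
have vQ := QXX_cvg_in_probability T_gt0 (joint_wiener W_wiener B_wiener)
  (joint_wiener_independent W_wiener WB_indep) mX X_path eps0.
set chi := chi2_upper _ _.
pose H n := [set om | chi < n%:R * contrast (vech (QXX T X n om)) (thhat n om)].
have mH n : (0 < n)%N -> measurable (H n).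
  move=> n0.
  apply: (@measurable_min_gt _ _ _ _ (fun om => vech (QXX T X n om)) _ _ Thetaks
     (fun v th => n%:R * contrast v th)).
  - move=> i; have [ij vE] := @vech_entry R p i; under eq_fun do rewrite vE.
    exact: measurable_QXX.
  - move=> th v; have cc : continuous (fun v : 'cV[R]_(pbar p) => contrast v th).
      exact: contrast_continuous.
    exact: (cvgM (cvg_cst _) (cc v)).
  - move=> om; exact: (is_minimizerZ (ler0n R n) (thhat_min n om n0)).
(* [thhat] is a minimizer for positive [n] only, so [H 0] need not be measurable; the index 0 gets
   the empty set. *)
pose C n := if (0 < n)%N then ~` H n else set0.
have vC : vanishing P C.
  apply: (vanishing_sub _ vQ) => [n|].
    by rewrite /C; case: ifP => // n0; exact/measurableC/mH.
  near=> n; have n0 : (0 < n)%N by near: n; exact: nbhs_infty_gt.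
  have nc : chi / c < n%:R by near: n; exact: nbhs_infty_gtr.
  (* If [QXX] were close to its limit, the contrast at the estimator would be at least [c], and the
     statistic at least n c > chi; non-rejection is therefore contained in the vanishing event
     [vQ]. *)
  rewrite /C n0 => om /= /negP; rewrite -leNgt => le_chi.
  apply: contrapT => /forallNP good.
  have cle : c <= contrast (vech (QXX T X n om)) (thhat n om).
    apply: lb; last exact: (thhat_min n om n0).1.
    move=> l; have [ij vE] := @vech_entry R p l; rewrite !vE GG ltNge.
    exact/negP/good.
  move: nc; rewrite ltr_pdivrMr// ltNge => /negP; apply; apply: le_trans le_chi.
  by rewrite ler_wpM2l.
apply: cvg_trans (vanishingC vC); apply: near_eq_cvg; near=> n.
have n0 : (0 < n)%N by near: n; exact: nbhs_infty_gt.
by rewrite /C n0 setCK.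
Unshelve. all: end_near. Qed.
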